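(* Let $\sigma_W(z)=\sigma_W(z;\mathfrak g_2,\mathfrak g_3)$ be the Weierstrass sigma function with arbitrary invariants $\mathfrak g_2,\mathfrak g_3$, and let $w,\alpha,\beta$ be nonzero complex parameters, $\alpha\neq\beta$, such that $\sigma_W(w\beta)\ne0$, $\sigma_W(w(n+\alpha))\neq0$ for all $n\ge0$ and $\sigma_W(wn)\ne0$ for all $n\ge1$. Put, for $n\ge0$, $$\mu_n=\frac{\sigma_W(wn)}{\sigma_W(w(n+\alpha))},\qquad g_n=\frac{\sigma_W(w\alpha)}{\sigma_W(w\beta)}\,\frac{\sigma_W(w(n+\beta))}{\sigma_W(w(n+\alpha))},$$ $$\tilde g_n=\frac{\sigma_W(w\alpha)\,\sigma_W(w(\beta-\alpha))\,\sigma_W(w(n+\alpha+\beta+2))}{\sigma_W^2(w\beta)\,\sigma_W(w(n+\alpha+2))}.$$ Then $\mu_0=0$, $g_0=1$, and $$\mu_n\,\mu_{m+1}\,\tilde g_{n+m-1}=g_{n+m+1}-g_{m+1}g_n,\qquad n\ge1,\ m\ge0.$$ Consequently, if the linear functional with moments $g_n$ is nondegenerate, then its monic orthogonal polynomials $P_n(x)=P_n(x;\alpha,\beta)$ have the umbral classical property with respect to the operator $\mathcal D x^n=\mu_nx^{n-1}$: the polynomials $Q_n(x)=\mu_{n+1}^{-1}\mathcal DP_{n+1}(x)$, $n\ge0$, are orthogonal with respect to the nondegenerate functional with moments $\tilde g_n$. Moreover $Q_n(x)$ is obtained from $P_n(x)$ by the parameter change $\alpha\to\alpha+2$, $\bet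a\to\alpha+\beta+2$.
   Context: A linear functional on complex polynomials, given by its moments $m_n$ (its values on $x^n$), is nondegenerate if all Hankel determinants $\det|m_{i+k}|_{i,k=0}^{n-1}$, $n\ge1$, are nonzero; it then has unique monic orthogonal polynomials $P_n(x)=x^n+O(x^{n-1})$, which depend on the moments only up to a common nonzero factor. $\mathcal D$ is a linear operator on polynomials. For $\mathfrak g_2=\mathfrak g_3=0$ the sigma function is $\sigma_W(z)=z$. $P_n(x;\alpha,\beta)$ denotes the monic orthogonal polynomials of the functional with moments proportional to $\sigma_W(w(n+\beta))/\sigma_W(w(n+\alpha))$, with $w,\mathfrak g_2,\mathfrak g_3$ fixed. *)

(* Defs.v *)
From HB Require Import structures.
From mathcomp Require Import all_boot all_order all_algebra.
From mathcomp Require Import complex.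
From mathcomp Require Import all_classical all_reals all_analysis.

Set Implicit Arguments.
Unset Strict Implicit.
Unset Printing Implicit Defensive.

Import Order.TTheory GRing.Theory Num.Theory.
Import numFieldNormedType.Exports.

Local Open Scope classical_set_scope.
Local Open Scope ring_scope.
Local Open Scope complex_scope.

(* The complex numbers are R[i] for R : realType.  The alias
   R[i]^o is used where the topology of R[i] (hence limits of sequences and
   complex derivatives) is needed. *)

(* The functions zeta_W = sigma_W' / sigma_W and wp = - zeta_W' = - (log sigma_W)''
   attached to s = sigma_W; both are meaningful only off the zeros of s. *)
Definition zeta_of (R : realType) (s : R[i]^o -> R[i]^o) : R[i]^o -> R[i]^o :=
  fun z => derive1 s z / s z.

Definition wp_of (R : realType) (s : R[i]^o -> R[i]^o) : R[i]^o -> R[i]^o :=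
  fun z => - derive1 (zeta_of s) z.

(* s is the Weierstrass sigma function sigma_W(z; g2, g3), given by its
   invariants (not by a lattice, so that the degenerate cases
   g2 ^ 3 = 27 g3 ^ 2 are included): s is entire, s z = z + O(z ^ 3) at 0, and
   wp = - (log s)'' satisfies wp' ^ 2 = 4 wp ^ 3 - g2 wp - g3.  The zero of s
   at 0 gives wp its double pole there, and the normalization of s fixes the two
   constants of integration, so g2 and g3 determine s. *)
Definition weierstrass_sigma (R : realType) (g2 g3 : R[i]) (s : R[i] -> R[i]) :
    Prop :=
  (exists a : nat -> R[i], [/\ a 0%N = 0, a 1%N = 1, a 2%N = 0 &
     forall z : R[i],
       series (fun n => a n * z ^+ n : R[i]^o) @ \oo --> (s z : R[i]^o)]) /\
  (forall z : R[i], s z != 0 ->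
     derive1 (wp_of s) z ^+ 2 = 4 * wp_of s z ^+ 3 - g2 * wp_of s z - g3).

Definition functional_of_moments (R : realType) (m : nat -> R[i])
    (p : {poly R[i]}) : R[i] :=
  \sum_(i < size p) p`_i * m i.

Definition hankel_nondegenerate (R : realType) (m : nat -> R[i]) : Prop :=
  forall n, (1 <= n)%N -> \det (\matrix_(i < n, k < n) m (i + k)%N) != 0.

Definition monic_orthogonal (R : realType) (m : nat -> R[i])
    (P : nat -> {poly R[i]}) : Prop :=
  [/\ forall n, P n \is monic /\ size (P n) = n.+1,
      forall n k, n <> k -> functional_of_moments m (P n * P k) = 0 &
      forall n, functional_of_moments m (P n ^+ 2) != 0].

(* The monic polynomial of degree n orthogonal to all polynomials of lower
   degree; it exists and is unique when m is nondegenerate (otherwise the value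
   may be the default 0). *)
Definition monicOP (R : realType) (m : nat -> R[i]) (n : nat) : {poly R[i]} :=
  xget 0 [set p : {poly R[i]} | [/\ p \is monic, size p = n.+1 &
    forall k, (k < n)%N -> functional_of_moments m (p * 'X^k) = 0]].

(* P_n(x; alpha, beta), for fixed sigma and w; monicOP does not change when the
   moments are multiplied by a common nonzero factor. *)
Definition sigmaOP (R : realType) (sigma : R[i] -> R[i]) (w alpha beta : R[i]) :
    nat -> {poly R[i]} :=
  monicOP (fun n => sigma (w * (n%:R + beta)) / sigma (w * (n%:R + alpha))).

(* The linear operator x ^ n |-> mu n * x ^ (n - 1).  On x ^ 0 the exponent is
   truncated to 0, so that the image of 1 is mu 0 (which is 0 in all uses). *)
Definition umbralD (R : realType) (mu : nat -> R[i]) (p : {poly R[i]}) :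
    {poly R[i]} :=
  \sum_(i < size p) (p`_i * mu i) *: 'X^(i.-1).

(* Main.v *)
Require Import Defs.
From HB Require Import structures.
From mathcomp Require Import all_boot all_order all_algebra.
From mathcomp Require Import complex.
From mathcomp Require Import all_classical all_reals all_analysis.
From mathcomp Require Import zify ring.
Import Order.TTheory GRing.Theory Num.Theory.
Import numFieldNormedType.Exports.
Local Open Scope ring_scope.
Local Open Scope complex_scope.

(** The theorem rests on Weierstrass's three-term sigma identity
    (sigma_three_term), of which the relation between mu, g and gt is the case
    a = w n, b = w (m + 1), A = w alpha, B = w beta.

    The three-term identity follows by linear algebra from the duplication
    formula sigma(x + y) sigma(x - y) = A(x) B(y) - B(x) A(y), where A = sigma^2
    and B = sigma^2 wp.  Since sigma is given by its differential equation and
    not by a lattice, the duplication formula is proved as an identity of formal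
    power series in x and y.  Both sides F solve the bilinear wave equation
    F (F_xx - F_yy) = F_x^2 - F_y^2: the left side because its logarithm is a
    function of x + y plus a function of x - y (wave_sigma_product), the right
    side because of the equation wp'^2 = 4 wp^3 - g2 wp - g3 and its derivative
    (wave_two_term).  The wave equation determines a power series from its terms
    of degree 0 and 1 in y (wave_unique), and these agree.  Two analytic facts
    transfer the identity between functions and series: entire functions form a
    ring closed under derivation, on which sums of series are compatible with
    products and derivatives (representsM, represents_deriv), and the series is
    determined by the function (represents_inj).  The duplication formula also
    shows that sigma is odd.

    The relation between the moments says that the functionals L and Lt with
    moments g and gt satisfy Lt(D p * D q) = L(p q) - L(p) L(q) for all
    polynomials p, q (umbral_product).  As L(P_n) = 0 for n >= 1, the operator D
    carries the orthogonality of the P_(n+1) to that of the Q_n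
    (umbral_orthogonal).  Orthogonality with nonzero norms forces the Hankel
    determinants to be nonzero (monic_orthogonal_nondegenerate) and determines
    the monic polynomials, whence the last claim: up to a constant factor, gt is
    g with alpha + 2 and alpha + beta + 2 in place of alpha and beta. *)

Set Implicit Arguments.
Unset Strict Implicit.
Unset Printing Implicit Defensive.

(** * Formal power series *)

Record fps (S : Type) := Fps { fcoef :> nat -> S }.

Lemma fpsP (S : Type) (F G : fps S) : (forall n, F n = G n) -> F = G.
Proof. by case: F G => [f] [g] /= fg; congr Fps; apply: funext. Qed.

HB.instance Definition _ (S : Type) := gen_eqMixin (fps S).
HB.instance Definition _ (S : Type) := gen_choiceMixin (fps S).

Section FpsRing.
Variable S : comNzRingType.
Implicit Types F G H : fps S.

Definition fps_zero : fps S := Fps (fun=> 0).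
Definition fps_add F G : fps S := Fps (fun n => F n + G n).
Definition fps_opp F : fps S := Fps (fun n => - F n).

Fact fps_addA : associative fps_add.
Proof. by move=> F G H; apply: fpsP => n /=; rewrite addrA. Qed.
Fact fps_addC : commutative fps_add.
Proof. by move=> F G; apply: fpsP => n /=; rewrite addrC. Qed.
Fact fps_add0 : left_id fps_zero fps_add.
Proof. by move=> F; apply: fpsP => n /=; rewrite add0r. Qed.
Fact fps_addN : left_inverse fps_zero fps_opp fps_add.
Proof. by move=> F; apply: fpsP => n /=; rewrite addNr. Qed.

HB.instance Definition _ :=
  GRing.isZmodule.Build (fps S) fps_addA fps_addC fps_add0 fps_addN.

Definition fpsC (c : S) : fps S := Fps (fun n => if n is 0%N then c else 0).
Definition fps_mul F G : fps S :=
  Fps (fun n => \sum_(i < n.+1) F i * G (n - i)%N).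

Definition fps_trunc (n : nat) F : {poly S} := \poly_(i < n.+1) F i.

Lemma coef_trunc n F i : (i <= n)%N -> (fps_trunc n F)`_i = F i.
Proof. by rewrite coef_poly ltnS => ->. Qed.

(** The n-th coefficient of a product depends on the coefficients up to n only,
    so the ring laws and the Leibniz rule are inherited from polynomials that
    agree with the series up to degree n. *)
Lemma fps_mul_poly (p q : {poly S}) F G n :
  (forall i, (i <= n)%N -> p`_i = F i) -> (forall i, (i <= n)%N -> q`_i = G i) ->
  fps_mul F G n = (p * q)`_n.
Proof.
move=> pF qG; rewrite coefM; apply: eq_bigr => i _.
by rewrite pF ?qG ?leq_subr // -ltnS.
Qed.

Fact fps_mulC : commutative fps_mul.
Proof.
move=> F G; apply: fpsP => n.
rewrite (fps_mul_poly (@coef_trunc n F) (@coef_trunc n G)) mulrC.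
by rewrite -(fps_mul_poly (@coef_trunc n G) (@coef_trunc n F)).
Qed.

Fact fps_mulA : associative fps_mul.
Proof.
move=> F G H; apply: fpsP => n.
have tM (A B : fps S) i : (i <= n)%N ->
    (fps_trunc n A * fps_trunc n B)`_i = fps_mul A B i.
  move=> le_in; rewrite (@fps_mul_poly (fps_trunc n A) (fps_trunc n B)) //.
    by move=> j le_ji; rewrite coef_trunc // (leq_trans le_ji).
  by move=> j le_ji; rewrite coef_trunc // (leq_trans le_ji).
rewrite (fps_mul_poly (@coef_trunc n F) (tM G H)) mulrA.
by rewrite -(fps_mul_poly (tM F G) (@coef_trunc n H)).
Qed.

Fact fps_mul1 : left_id (fpsC 1) fps_mul.
Proof.
move=> F; apply: fpsP => n /=; rewrite big_ord_recl /= mul1r subn0 big1 ?addr0 //.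
by move=> i _; rewrite mul0r.
Qed.

Fact fps_mulD : left_distributive fps_mul fps_add.
Proof.
move=> F G H; apply: fpsP => n /=; rewrite -big_split /=.
by apply: eq_bigr => i _; rewrite mulrDl.
Qed.

Fact fps_one_neq0 : fpsC 1 != 0 :> fps S.
Proof.
by apply/eqP => /(congr1 (fun F : fps S => F 0%N)) /eqP; rewrite oner_eq0.
Qed.

HB.instance Definition _ := GRing.Zmodule_isComNzRing.Build (fps S)
  fps_mulA fps_mulC fps_mul1 fps_mulD fps_one_neq0.

Lemma coef_fpsD F G n : (F + G) n = F n + G n. Proof. by []. Qed.
Lemma coef_fpsN F n : (- F) n = - F n. Proof. by []. Qed.
Lemma coef_fps0 n : (0 : fps S) n = 0. Proof. by []. Qed.
Lemma coef_fpsM F G n : (F * G) n = \sum_(i < n.+1) F i * G (n - i)%N.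
Proof. by []. Qed.
Lemma coef_fpsCM c F n : (fpsC c * F) n = c * F n.
Proof.
rewrite coef_fpsM big_ord_recl /= subn0 big1 ?addr0 // => i _.
by rewrite mul0r.
Qed.

Lemma fpsCM c d : fpsC (c * d) = fpsC c * fpsC d.
Proof. by apply: fpsP => -[|n]; rewrite coef_fpsCM //= mulr0. Qed.

Definition fpsD F : fps S := Fps (fun n => F n.+1 *+ n.+1).

Lemma fpsD_add F G : fpsD (F + G) = fpsD F + fpsD G.
Proof. by apply: fpsP => n /=; rewrite mulrnDl. Qed.
Lemma fpsD_opp F : fpsD (- F) = - fpsD F.
Proof. by apply: fpsP => n /=; rewrite mulNrn. Qed.
Lemma fpsD_mul F G : fpsD (F * G) = fpsD F * G + F * fpsD G.
Proof.
apply: fpsP => n.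
have tD H i : (i <= n)%N -> (fps_trunc n.+1 H)^`()`_i = fpsD H i.
  by move=> le_in; rewrite coef_deriv coef_trunc.
have tE H i : (i <= n)%N -> (fps_trunc n.+1 H)`_i = H i.
  by move=> le_in; rewrite coef_trunc // leqW.
rewrite coef_fpsD (fps_mul_poly (tD F) (tE G)) (fps_mul_poly (tE F) (tD G)).
rewrite -coefD -derivM coef_deriv.
by rewrite -(fps_mul_poly (@coef_trunc n.+1 F) (@coef_trunc n.+1 G)).
Qed.
Lemma fpsD_C c : fpsD (fpsC c) = 0.
Proof. by apply: fpsP => n /=; rewrite mul0rn. Qed.

Definition fpsX : fps S := Fps (fun n => (n == 1%N)%:R).

Lemma coef_fpsXM F n : (fpsX * F) n = if n is n'.+1 then F n' else 0.
Proof.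
case: n => [|n]; first by rewrite coef_fpsM big_ord1 mul0r.
rewrite coef_fpsM 2!big_ord_recl /= mul0r add0r mul1r subSS subn0.
by rewrite big1 ?addr0 // => i _; rewrite mul0r.
Qed.

End FpsRing.

(** The lowest nonzero coefficient of F times that of G would be the lowest
    nonzero coefficient of F * G. *)
Lemma fps_lreg (S : idomainType) (m : nat) (F G : fps S) :
  (forall i, (i < m)%N -> F i = 0) -> F m != 0 -> F * G = 0 -> G = 0.
Proof.
move=> F0 Fm FG0; apply: fpsP => n; rewrite coef_fps0.
elim/ltn_ind: n => n IH.
have := congr1 (fun H : fps S => H (m + n)%N) FG0.
rewrite coef_fps0 coef_fpsM.
have mlt : (m < (m + n).+1)%N by rewrite ltnS leq_addr.
rewrite (bigD1 (Ordinal mlt)) //= addKn big1 ?addr0.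
  by move/eqP; rewrite mulf_eq0 (negPf Fm) /= => /eqP.
move=> i; rewrite -val_eqE /= neq_ltn => /orP[lt_im|lt_mi]; first by rewrite F0 ?mul0r.
rewrite IH ?mulr0 // ltn_subLR ?ltn_add2r //.
by rewrite -ltnS.
Qed.

Section Morph.
Variables (S U : comNzRingType) (h : {rmorphism S -> U}).

Definition fps_map (F : fps S) : fps U := Fps (fun n => h (F n)).

Fact fps_map_is_zmod : zmod_morphism fps_map.
Proof. by move=> F G; apply: fpsP => n /=; rewrite rmorphB. Qed.
Fact fps_map_is_monoid : monoid_morphism fps_map.
Proof.
split; first by apply: fpsP => -[|n] /=; rewrite ?rmorph1 ?rmorph0.
move=> F G; apply: fpsP => n /=; rewrite rmorph_sum.
by apply: eq_bigr => i _; rewrite rmorphM.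
Qed.
HB.instance Definition _ :=
  GRing.isZmodMorphism.Build (fps S) (fps U) fps_map fps_map_is_zmod.
HB.instance Definition _ :=
  GRing.isMonoidMorphism.Build (fps S) (fps U) fps_map fps_map_is_monoid.

(** The substitution t := mu t, after the change of coefficients h. *)
Definition fps_scale (mu : U) (F : fps S) : fps U :=
  Fps (fun n => h (F n) * mu ^+ n).

Variable mu : U.
Fact fps_scale_is_zmod : zmod_morphism (fps_scale mu).
Proof. by move=> F G; apply: fpsP => n /=; rewrite rmorphB mulrBl. Qed.
Fact fps_scale_is_monoid : monoid_morphism (fps_scale mu).
Proof.
split.
  by apply: fpsP => -[|n] /=; rewrite ?rmorph1 ?rmorph0 ?mul0r ?mul1r ?expr0.
move=> F G; apply: fpsP => n /=; rewrite rmorph_sum mulr_suml.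
apply: eq_bigr => i _; rewrite rmorphM.
have -> : mu ^+ n = mu ^+ i * mu ^+ (n - i) by rewrite -exprD subnKC // -ltnS.
ring.
Qed.
HB.instance Definition _ :=
  GRing.isZmodMorphism.Build (fps S) (fps U) (fps_scale mu) fps_scale_is_zmod.
HB.instance Definition _ :=
  GRing.isMonoidMorphism.Build (fps S) (fps U) (fps_scale mu)
    fps_scale_is_monoid.
End Morph.

(** * Series in two variables and the bilinear wave equation *)

Section Bivariate.
Variable K : numFieldType.
Local Notation S := {poly K}.
Implicit Types F G : fps S.

(** A series in two variables x, y is written here as a series in t over
    K[lambda], with x = t and y = lambda t: the coefficient of t^n is its
    homogeneous part of degree n.  Then epsD = d/dlambda is t d/dy, and deltaD
    = t d/dt - lambda d/dlambda is x d/dx, that is t d/dx.  This encoding makes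
    the passage to numbers a plain evaluation of lambda. *)
Definition epsD F : fps S := Fps (fun n => (F n)^`()).
Definition deltaD F : fps S := fpsX S * fpsD F - fpsC 'X * epsD F.

Lemma epsD_add F G : epsD (F + G) = epsD F + epsD G.
Proof. by apply: fpsP => n /=; rewrite derivD. Qed.
Lemma epsD_opp F : epsD (- F) = - epsD F.
Proof. by apply: fpsP => n /=; rewrite derivN. Qed.
Lemma epsD_mul F G : epsD (F * G) = epsD F * G + F * epsD G.
Proof.
apply: fpsP => n; rewrite coef_fpsD !coef_fpsM -big_split /= raddf_sum.
by apply: eq_bigr => i _ /=; rewrite -derivM.
Qed.

Lemma deltaD_add F G : deltaD (F + G) = deltaD F + deltaD G.
Proof. rewrite /deltaD fpsD_add epsD_add; ring. Qed.
Lemma deltaD_opp F : deltaD (- F) = - deltaD F.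
Proof. rewrite /deltaD fpsD_opp epsD_opp; ring. Qed.
Lemma deltaD_mul F G : deltaD (F * G) = deltaD F * G + F * deltaD G.
Proof. rewrite /deltaD fpsD_mul epsD_mul; ring. Qed.

Lemma deltaD_X : deltaD (fpsX S) = fpsX S.
Proof.
apply: fpsP => n; rewrite /deltaD coef_fpsD coef_fpsN coef_fpsXM coef_fpsCM /=.
have -> : ((n == 1%N)%:R : S)^`() = 0 by case: eqP => _; rewrite ?derivC // deriv0.
rewrite mulr0 subr0; case: n => [|[|n]] //=.
by rewrite mul0rn.
Qed.

Lemma epsD_X : epsD (fpsX S) = 0.
Proof.
by apply: fpsP => n /=; case: eqP => _; rewrite ?derivC // deriv0.
Qed.

Local Notation sc := (fps_scale (@polyC K)).

Lemma epsD_scale (mu : S) (f : fps K) :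
  epsD (sc mu f) = fpsC mu^`() * (fpsX S * sc mu (fpsD f)).
Proof.
apply: fpsP => n; rewrite coef_fpsCM coef_fpsXM /=.
case: n => [|n] /=; first by rewrite expr0 mulr1 derivC mulr0.
rewrite derivM derivC mul0r add0r deriv_exp /= polyCMn.
rewrite !(mulrnAl, mulrnAr); congr (_ *+ _); ring.
Qed.

Lemma deltaD_scale (mu : S) (f : fps K) :
  deltaD (sc mu f) = fpsC (mu - 'X * mu^`()) * (fpsX S * sc mu (fpsD f)).
Proof.
have thE : fpsX S * fpsD (sc mu f) = fpsC mu * (fpsX S * sc mu (fpsD f)).
  apply: fpsP => n; rewrite coef_fpsCM !coef_fpsXM.
  case: n => [|n] /=; first by rewrite mulr0.
  by rewrite polyCMn exprS !(mulrnAl, mulrnAr) mulrCA.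
rewrite /deltaD thE epsD_scale mulrA -fpsCM.
set F := _ * sc _ _; apply: fpsP => n.
by rewrite coef_fpsD coef_fpsN !coef_fpsCM mulrBl.
Qed.

(** The operator F (F_xx - F_yy) - F_x^2 + F_y^2, multiplied by t^2: since
    deltaD is x d/dx, the second derivative x^2 d^2/dx^2 is deltaD^2 - deltaD.
    Where F is nonzero, it vanishes exactly when log F solves the wave
    equation. *)
Definition wave F : fps S :=
  F * (deltaD (deltaD F) - deltaD F - epsD (epsD F))
  - deltaD F ^+ 2 + epsD F ^+ 2.

(** Divisibility by lambda^j, hence by y^j. *)
Definition lowdeg j F := forall n i, (i < j)%N -> (F n)`_i = 0.

Lemma lowdegD j F G : lowdeg j F -> lowdeg j G -> lowdeg j (F + G).
Proof. by move=> hF hG n i lt; rewrite coef_fpsD coefD hF // hG // addr0. Qed.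
Lemma lowdegN j F : lowdeg j F -> lowdeg j (- F).
Proof. by move=> hF n i lt; rewrite coef_fpsN coefN hF // oppr0. Qed.
Lemma lowdegM j k F G : lowdeg j F -> lowdeg k G -> lowdeg (j + k) (F * G).
Proof.
move=> hF hG n i lt; rewrite coef_fpsM coef_sum big1 // => m _.
rewrite coefM big1 // => l _.
case: (ltnP l j) => [/hF -> |jl]; first by rewrite mul0r.
by rewrite hG ?mulr0 //; have := ltn_ord l; lia.
Qed.
Lemma lowdegMl j F G : lowdeg j F -> lowdeg j (F * G).
Proof. by move=> hF; rewrite -[j]addn0; apply: lowdegM. Qed.
Lemma lowdeg_eps j F : lowdeg j.+1 F -> lowdeg j (epsD F).
Proof. by move=> hF n i lt; rewrite /= coef_deriv hF ?mul0rn. Qed.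
Lemma lowdeg_delta j F : lowdeg j F -> lowdeg j (deltaD F).
Proof.
move=> hF n i lt; rewrite /deltaD coef_fpsD coef_fpsN coef_fpsXM coef_fpsCM.
rewrite coefB coefXM; case: n => [|n] /=.
  case: i lt => [|i] lt; rewrite ?coef0 ?subr0 //=.
  by rewrite coef_deriv hF ?mul0rn ?subrr.
rewrite coefMn hF // mul0rn sub0r; case: i lt => [|i] lt; rewrite ?oppr0 //=.
by rewrite coef_deriv hF ?mul0rn ?oppr0.
Qed.
Lemma lowdegW j k F : (k <= j)%N -> lowdeg j F -> lowdeg k F.
Proof. by move=> le hF n i lt; apply: hF; apply: leq_trans le. Qed.

Definition lcoef j F : fps K := Fps (fun n => (F n)`_j).

Lemma lcoefM_low j F G : lowdeg j G -> lcoef j (F * G) = lcoef 0 F * lcoef j G.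
Proof.
move=> hG; apply: fpsP => n; rewrite coef_fpsM /= coef_sum.
apply: eq_bigr => i _; rewrite coefM big_ord_recl /= subn0 big1 ?addr0 // => l _.
by rewrite hG ?mulr0 // /bump /=; have := ltn_ord l; lia.
Qed.

(** A solution of the bilinear wave equation is determined by its coefficients
    of y^0 and y^1, if the former is regular and the latter vanishes: when the
    difference d of two solutions is divisible by y^(j+2), every term of the
    difference of the two equations is divisible by y^(j+1), except G d_yy,
    whose coefficient of y^j is (j + 2)(j + 1) G_0 d_(j+2). *)
Lemma wave_unique F G :
    wave F = 0 -> wave G = 0 -> lowdeg 2 (F - G) -> lowdeg 1 (epsD (F + G)) ->
    (forall H : fps K, lcoef 0 G * H = 0 -> H = 0) ->
  F = G.
Proof.
move=> wF wG; set d := F - G => d2 e1 reg.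
have dE : G * epsD (epsD d) =
    d * (deltaD (deltaD F) - deltaD F - epsD (epsD F))
    + G * (deltaD (deltaD d) - deltaD d)
    - deltaD d * deltaD (F + G) + epsD d * epsD (F + G).
  apply/eqP; rewrite -subr_eq0 -oppr_eq0; apply/eqP.
  transitivity (wave F - wave G); last by rewrite wF wG subrr.
  rewrite /wave /d !(deltaD_add, epsD_add, deltaD_opp, epsD_opp); ring.
have IH j : lowdeg j.+2 d.
  elim: j => [//|j IHj].
  have low1 : lowdeg j.+1 (G * epsD (epsD d)).
    rewrite dE; apply: lowdegD; [apply: lowdegD; [apply: lowdegD|]|].
    - by apply: lowdegMl; apply: lowdegW IHj.
    - rewrite mulrC; apply: lowdegMl; apply: lowdegW (leqnSn _) _.
      by apply: lowdegD; [|apply: lowdegN]; do ?apply: lowdeg_delta.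
    - apply: lowdegN; apply: lowdegMl; apply: lowdegW (leqnSn _) _.
      exact: lowdeg_delta.
    - by rewrite -addn1; apply: lowdegMl; rewrite addn1; apply: lowdeg_eps.
  have low0 : lowdeg j (epsD (epsD d)) by do 2!apply: lowdeg_eps.
  have /reg z : lcoef 0 G * lcoef j (epsD (epsD d)) = 0.
    by rewrite -lcoefM_low //; apply: fpsP => n; apply: low1.
  move=> n i; rewrite ltnS leq_eqVlt => /orP[/eqP->|]; last exact: IHj.
  have /eqP := congr1 (fun H : fps K => H n) z.
  rewrite /= !coef_deriv -mulrnA -mulr_natr mulf_eq0 pnatr_eq0 muln_eq0 /= orbF.
  by move/eqP.
apply/eqP; rewrite -subr_eq0; apply/eqP/fpsP => n; apply/polyP => i.
by rewrite (IH i n i) ?coef0.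
Qed.

End Bivariate.

(** * The duplication formula for the formal sigma series *)

Section FormalSigma.
Variables (K : numFieldType) (s : fps K) (g2 g3 : K).
Hypotheses (s_0 : s 0%N = 0) (s_1 : s 1%N = 1) (s_2 : s 2%N = 0).

Let s1 := fpsD s.
Let s2 := fpsD s1.
Let s3 := fpsD s2.
Let s4 := fpsD s3.

(** sigma^2 wp, the numerator of wp = - (log sigma)''; the numerator C of wp'
    is sigma^3 wp'. *)
Definition sigma2wp : fps K := s1 ^+ 2 - s * s2.
Let C : fps K := 3 * s * s1 * s2 - s ^+ 2 * s3 - 2 * s1 ^+ 3.

Let c2 := fpsC g2.
Let c3 := fpsC g3.

Hypothesis sigma_ode_fps :
  C ^+ 2 = 4 * sigma2wp ^+ 3 - c2 * sigma2wp * s ^+ 4 - c3 * s ^+ 6.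

Lemma sigma_lreg (F : fps K) : s * F = 0 -> F = 0.
Proof.
apply: (@fps_lreg K 1) => [[|//] _|]; rewrite ?s_0 //.
by rewrite s_1 oner_neq0.
Qed.

Lemma wp1num_lreg (F : fps K) : C * F = 0 -> F = 0.
Proof.
have s1_0 : s1 0%N = 1 by rewrite /s1 /= s_1.
apply: (@fps_lreg K 0) => //.
have h0 (F1 F2 : fps K) : (F1 * F2) 0%N = F1 0%N * F2 0%N.
  by rewrite coef_fpsM big_ord1 subnn.
rewrite /C !coef_fpsD !coef_fpsN !exprS expr0 !h0 s_0 s1_0 !(mul0r, mulr0, oppr0, add0r).
have n2 : (2 : fps K) 0%N = 2 by rewrite coef_fpsD.
by rewrite n2 !mulr1 oppr_eq0 pnatr_eq0.
Qed.

(** The equation wp'^2 = 4 wp^3 - g2 wp - g3 multiplied by sigma^6 has the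
    superfluous factor sigma^2; without it, the equation has degree 4 in
    sigma, which is the degree needed in the wave equation below. *)
Lemma sigma_first_integral :
  s ^+ 2 * s3 ^+ 2 - 6 * s * s1 * s2 * s3 + 4 * s1 ^+ 3 * s3 + 4 * s * s2 ^+ 3
  - 3 * s1 ^+ 2 * s2 ^+ 2 + c2 * sigma2wp * s ^+ 2 + c3 * s ^+ 4 = 0.
Proof.
apply: sigma_lreg; apply: sigma_lreg.
move/eqP: sigma_ode_fps; rewrite -subr_eq0 => /eqP <-.
rewrite /C /sigma2wp; ring.
Qed.

(** The equation wp'' = 6 wp^2 - g2 / 2 in Hirota's bilinear form, obtained by
    differentiating the first integral and cancelling the factor wp'. *)
Lemma sigma_bilinear :
  s * s4 - 4 * s1 * s3 + 3 * s2 ^+ 2 = fpsC (g2 / 2) * s ^+ 2.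
Proof.
set e2 := fpsC (g2 / 2).
have c2E : c2 = 2 * e2.
  have -> : 2 = fpsC (2 : K) by apply: fpsP => -[|n]; rewrite coef_fpsD /= ?addr0.
  by rewrite -fpsCM mulrCA divff ?mulr1 ?pnatr_eq0.

have : fpsD (s ^+ 2 * s3 ^+ 2 - 6 * s * s1 * s2 * s3 + 4 * s1 ^+ 3 * s3
  + 4 * s * s2 ^+ 3 - 3 * s1 ^+ 2 * s2 ^+ 2 + c2 * sigma2wp * s ^+ 2 + c3 * s ^+ 4) = 0.
  by rewrite sigma_first_integral; apply: fpsP => n /=; rewrite mul0rn.
have Dn n : fpsD (n%:R : fps K) = 0.
  elim: n => [|n IH]; first by apply: fpsP => n /=; rewrite mul0rn.
  by rewrite -natr1 fpsD_add IH add0r; exact: fpsD_C.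
rewrite /sigma2wp !exprS !expr0 !(fpsD_add, fpsD_opp, fpsD_mul, fpsD_C, Dn).
rewrite -/s1 -/s2 -/s3 -/s4.
move=> DE; apply/eqP; rewrite -subr_eq0; apply/eqP.
have two_reg (F : fps K) : 2 * F = 0 -> F = 0.
  by apply: (@fps_lreg K 0) => //; have /negbT := pnatr_eq0 K 2.
apply/two_reg/wp1num_lreg.
(* The left side is 4 s1 E - s E', where E is the first integral. *)
transitivity (4 * s1 * (s ^+ 2 * s3 ^+ 2 - 6 * s * s1 * s2 * s3
  + 4 * s1 ^+ 3 * s3 + 4 * s * s2 ^+ 3 - 3 * s1 ^+ 2 * s2 ^+ 2
  + c2 * sigma2wp * s ^+ 2 + c3 * s ^+ 4) - s * 0); last first.
  by rewrite sigma_first_integral !mulr0 subr0.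
rewrite -DE /C /sigma2wp c2E; ring.
Qed.


Local Notation S := {poly K}.
Local Notation sc := (fps_scale (@polyC K)).

Let fpsA := s ^+ 2.
(* The two sides of the duplication formula, with x = t and y = lambda t. *)
Let p := sc (1 + 'X) s * sc (1 - 'X) s.
Let k := sc 1 fpsA * sc 'X sigma2wp - sc 1 sigma2wp * sc 'X fpsA.

Let fpsC0 : fpsC (0 : S) = 0. Proof. by apply: fpsP => -[|n]. Qed.

Let dC : (1 + 'X : S)^`() = 1. Proof. by rewrite derivD derivX derivC add0r. Qed.
Let dC' : (1 - 'X : S)^`() = -1. Proof. by rewrite derivB derivX derivC sub0r. Qed.

Lemma dscale1 (f : fps K) : deltaD (sc 1 f) = fpsX S * sc 1 (fpsD f).
Proof. by rewrite deltaD_scale derivC mulr0 subr0 mul1r. Qed.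
Lemma escale1 (f : fps K) : epsD (sc 1 f) = 0.
Proof. by rewrite epsD_scale derivC fpsC0 mul0r. Qed.
Lemma dscaleX (f : fps K) : deltaD (sc 'X f) = 0.
Proof. by rewrite deltaD_scale derivX mulr1 subrr fpsC0 mul0r. Qed.
Lemma escaleX (f : fps K) : epsD (sc 'X f) = fpsX S * sc 'X (fpsD f).
Proof. by rewrite epsD_scale derivX mul1r. Qed.
Lemma dscaleP (f : fps K) :
  deltaD (sc (1 + 'X) f) = fpsX S * sc (1 + 'X) (fpsD f).
Proof. by rewrite deltaD_scale dC mulr1 addrK mul1r. Qed.
Lemma escaleP (f : fps K) :
  epsD (sc (1 + 'X) f) = fpsX S * sc (1 + 'X) (fpsD f).
Proof. by rewrite epsD_scale dC mul1r. Qed.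
Lemma dscaleM (f : fps K) :
  deltaD (sc (1 - 'X) f) = fpsX S * sc (1 - 'X) (fpsD f).
Proof. by rewrite deltaD_scale dC' mulrN1 opprK subrK mul1r. Qed.
Lemma escaleM (f : fps K) :
  epsD (sc (1 - 'X) f) = - (fpsX S * sc (1 - 'X) (fpsD f)).
Proof.
rewrite epsD_scale dC'; have -> : fpsC (-1 : S) = - 1; last by rewrite mulN1r.
by apply: fpsP => -[|n] //=; rewrite oppr0.
Qed.

(** log (sigma(x + y) sigma(x - y)) is a function of x + y plus a function of
    x - y. *)
Lemma wave_sigma_product : wave p = 0.
Proof.
rewrite /wave /p.
rewrite !(deltaD_add, epsD_add, deltaD_opp, epsD_opp, deltaD_mul, epsD_mul,
  dscaleP, escaleP, dscaleM, escaleM, deltaD_X, epsD_X).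
ring.
Qed.

(** For k = A(x) B(y) - B(x) A(y) with A = sigma^2 and B = sigma^2 wp, the
    bilinear equation gives A'' and B'' in terms of sigma, ..., sigma''', and
    the wave operator of k becomes
    t^2 (E(y) sigma(x)^4 - E(x) sigma(y)^4), E being the first integral. *)
Lemma wave_two_term : wave k = 0.
Proof.
have dA : fpsD fpsA = 2 * s * s1 by rewrite /fpsA expr2 fpsD_mul -/s1; ring.
have dB : fpsD sigma2wp = s1 * s2 - s * s3.
  by rewrite /sigma2wp fpsD_add fpsD_opp expr2 !fpsD_mul -/s1 -/s2 -/s3; ring.
have ddA : fpsD (fpsD fpsA) = 2 * s1 ^+ 2 + 2 * s * s2.
  by rewrite /fpsA expr2 fpsD_mul fpsD_add !fpsD_mul -/s1 -/s2; ring.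
have ddB : fpsD (fpsD sigma2wp) = 4 * s2 ^+ 2 - 4 * s1 * s3 - fpsC (g2 / 2) * s ^+ 2.
  rewrite dB fpsD_add fpsD_opp !fpsD_mul -/s1 -/s2 -/s3 -/s4 -sigma_bilinear; ring.
have E1 := congr1 (sc 1) sigma_first_integral.
have EX := congr1 (sc 'X) sigma_first_integral.
have dk : deltaD k =
    fpsX S * (sc 1 (fpsD fpsA) * sc 'X sigma2wp
      - sc 1 (fpsD sigma2wp) * sc 'X fpsA).
  by rewrite /k deltaD_add deltaD_opp !deltaD_mul !dscale1 !dscaleX; ring.
have ek : epsD k =
    fpsX S * (sc 1 fpsA * sc 'X (fpsD sigma2wp)
      - sc 1 sigma2wp * sc 'X (fpsD fpsA)).
  by rewrite /k epsD_add epsD_opp !epsD_mul !escale1 !escaleX; ring.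
have ddk : deltaD (deltaD k) - deltaD k =
    fpsX S ^+ 2 * (sc 1 (fpsD (fpsD fpsA)) * sc 'X sigma2wp
      - sc 1 (fpsD (fpsD sigma2wp)) * sc 'X fpsA).
  rewrite dk deltaD_mul deltaD_X deltaD_add deltaD_opp !deltaD_mul !dscale1 !dscaleX.
  ring.
have eek : epsD (epsD k) =
    fpsX S ^+ 2 * (sc 1 fpsA * sc 'X (fpsD (fpsD sigma2wp))
      - sc 1 sigma2wp * sc 'X (fpsD (fpsD fpsA))).
  rewrite ek epsD_mul epsD_X epsD_add epsD_opp !epsD_mul !escale1 !escaleX.
  ring.
rewrite /wave ddk eek dk ek ddA ddB dA dB /k.
rewrite rmorph0 in E1; rewrite rmorph0 in EX.
have c2E : c2 = fpsC (g2 / 2) + fpsC (g2 / 2).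
  by apply: fpsP => -[|n]; rewrite coef_fpsD /= ?addr0 // -splitr.
move: (g2 / 2) c2E => h2 c2E.
have scC mu c : sc mu (fpsC c) = fpsC c%:P.
  by apply: fpsP => -[|n] /=; rewrite ?expr0 ?mulr1 // mul0r.
rewrite /fpsA /sigma2wp !(rmorph_nat, rmorphXn, rmorphD, rmorphN, rmorphM) /= !scC.
move: E1 EX.
rewrite /sigma2wp c2E !(rmorph_nat, rmorphXn, rmorphD, rmorphN, rmorphM) /= !scC.
set e2 := fpsC h2%:P; set e3 := fpsC g3%:P.
move: (fpsX S) => T.
move: (sc 1 s) (sc 1 s1) (sc 1 s2) (sc 1 s3) => x0 x1 x2 x3.
move: (sc 'X s) (sc 'X s1) (sc 'X s2) (sc 'X s3) => y0 y1 y2 y3.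
set E1 := (X in X = 0 -> _); set EX := (X in _ -> X = 0 -> _) => E10 EX0.
transitivity (T ^+ 2 * (EX * x0 ^+ 4 - E1 * y0 ^+ 4)).
  rewrite /E1 /EX; ring.
by rewrite E10 EX0 !mul0r subrr mulr0.
Qed.

(** Both sides solve the wave equation, equal sigma(x)^2 at y = 0, and have no
    term in y^1. *)
Lemma sigma_duplication_fps : p = k.
Proof.
have c0 mu (f : fps K) : lcoef 0 (sc mu f) = fps_scale idfun mu.[0] f.
  by apply: fpsP => n /=; rewrite -horner_coef0 hornerM hornerC horner_exp.
have c0M (F G : fps S) : lcoef 0 (F * G) = lcoef 0 F * lcoef 0 G.
  exact: lcoefM_low.
have c0D (F G : fps S) : lcoef 0 (F + G) = lcoef 0 F + lcoef 0 G.
  by apply: fpsP => n; rewrite /= coefD.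
have c0N (F : fps S) : lcoef 0 (- F) = - lcoef 0 F.
  by apply: fpsP => n; rewrite /= coefN.
have sc1 f : fps_scale idfun (1 : K) f = f.
  by apply: fpsP => n; rewrite /= expr1n mulr1.
have sc0 f : fps_scale idfun (0 : K) f = fpsC (f 0%N).
  by apply: fpsP => -[|n]; rewrite /= ?expr0 ?mulr1 // expr0n mulr0.
have h1 : (1 + 'X : S).[0] = 1 by rewrite !hornerE.
have h2 : (1 - 'X : S).[0] = 1 by rewrite !hornerE subr0.
have low1P (F : fps S) : lcoef 0 F = 0 -> lowdeg 1 F.
  by move=> F0 n [|//] _; have := congr1 (fun H : fps K => H n) F0.
have low2P (F : fps S) : lcoef 0 F = 0 -> lcoef 0 (epsD F) = 0 -> lowdeg 2 F.
  move=> F0 F1 n [|[|//]] _; first exact: low1P.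
  by have := congr1 (fun H : fps K => H n) F1; rewrite /= coef_deriv.
have A0 : fpsA 0%N = 0 by rewrite /fpsA expr2 coef_fpsM big_ord1 s_0 mul0r.
have B0 : sigma2wp 0%N = 1.
  rewrite /sigma2wp coef_fpsD coef_fpsN expr2 !coef_fpsM !big_ord1 s_0 mul0r subr0 /=.
  by rewrite s_1 mulr1.
have dA0 : fpsD fpsA 0%N = 0.
  by rewrite /fpsA expr2 fpsD_mul coef_fpsD !coef_fpsM !big_ord1 s_0 mul0r mulr0 addr0.
have dB0 : fpsD sigma2wp 0%N = 0.
  rewrite /sigma2wp fpsD_add fpsD_opp expr2 !fpsD_mul coef_fpsD coef_fpsN.
  rewrite !coef_fpsD !coef_fpsM !big_ord1 /= s_0 s_2; ring.
have p0 : lcoef 0 p = s ^+ 2 by rewrite /p c0M !c0 h1 h2 !sc1 expr2.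
have k0 : lcoef 0 k = s ^+ 2.
  rewrite /k c0D c0N !c0M !c0 hornerC hornerX !sc1 !sc0 A0 B0.
  have -> : fpsC (0 : K) = 0 by apply: fpsP => -[|n].
  by rewrite mulr0 subr0 mulr1.
have p1 : lcoef 0 (epsD p) = 0.
  rewrite /p epsD_mul escaleP escaleM c0D !c0M c0N !c0M !c0 h1 h2 !sc1; ring.
have k1 : lcoef 0 (epsD k) = 0.
  rewrite /k epsD_add epsD_opp !epsD_mul !escale1 !escaleX !mul0r !add0r.
  rewrite c0D c0N !c0M !c0 hornerX !sc0 dA0 dB0.
  have -> : fpsC (0 : K) = 0 by apply: fpsP => -[|n].
  by rewrite !mulr0 subrr.
apply: wave_unique wave_sigma_product wave_two_term _ _ _.
- by apply: low2P; rewrite ?epsD_add ?epsD_opp c0D c0N ?p0 ?k0 ?p1 ?k1 subrr.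
- by apply: low1P; rewrite epsD_add c0D p1 k1 addr0.
- by move=> H; rewrite k0 expr2 -mulrA => /sigma_lreg/sigma_lreg.
Qed.

(** The duplication formula along the line y = l x. *)
Lemma duplication_scaled (l : K) :
  fps_scale idfun (1 + l) s * fps_scale idfun (1 - l) s
  = s ^+ 2 * fps_scale idfun l sigma2wp - sigma2wp * fps_scale idfun l (s ^+ 2).
Proof.
have mE mu (f : fps K) :
    fps_map (horner_eval l) (sc mu f) = fps_scale idfun mu.[l] f.
  apply: fpsP => n /=.
  by rewrite /horner_eval hornerM hornerC horner_exp.
have sc1 f : fps_scale idfun (1 : K) f = f.
  by apply: fpsP => n; rewrite /= expr1n mulr1.
have := congr1 (fps_map (horner_eval l)) sigma_duplication_fps.
rewrite /p /k /fpsA rmorphB !rmorphM /= !mE !hornerE !sc1.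
by [].
Qed.
End FormalSigma.

(** * Convergence of complex series *)

Section ComplexSeries.
Variable R : realType.
Implicit Types (c d : nat -> R[i]) (k l z : R[i]).

Local Open Scope classical_set_scope.
Local Notation nc := (@Normc.normc R).

Lemma nc_norm z : `|z| = (nc z)%:C. Proof. by []. Qed.
Lemma nc_ge0 z : 0 <= nc z.
Proof. by rewrite -lecR -nc_norm normr_ge0. Qed.
Lemma ncD z l : nc (z + l) <= nc z + nc l. Proof. exact: le_normcD. Qed.
Lemma ncM z l : nc (z * l) = nc z * nc l. Proof. exact: Normc.normcM. Qed.
Lemma ncN z : nc (- z) = nc z. Proof. exact: normcN. Qed.
Lemma nc_eq0 z : nc z = 0 -> z = 0. Proof. exact: Normc.eq0_normc. Qed.
Lemma ncX z n : nc (z ^+ n) = nc z ^+ n.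
Proof.
elim: n => [|n IH]; first by rewrite !expr0 Normc.normc1.
by rewrite !exprS ncM IH.
Qed.
Lemma nc_sum c n : nc (\sum_(i < n) c i) <= \sum_(i < n) nc (c i).
Proof.
elim: n => [|n IH]; first by rewrite !big_ord0 Normc.normc0.
by rewrite !big_ord_recr /= (le_trans (ncD _ _)) // lerD2r.
Qed.
Lemma nc_real (x : R) : 0 <= x -> nc x%:C = x.
Proof. by move=> x0; rewrite /Normc.normc /= expr0n /= addr0 sqrtr_sqr ger0_norm. Qed.
Lemma nc_nat n : nc n%:R = n%:R.
Proof. by rewrite -(nc_real (ler0n R n)) rmorph_nat. Qed.

Lemma cvg0_le (u v : nat -> R) : (forall n, 0 <= u n) -> (forall n, u n <= v n) ->
  v n @[n --> \oo] --> (0 : R) -> u n @[n --> \oo] --> (0 : R).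
Proof.
move=> u0 uv v0; apply: squeeze_cvgr (cvg_cst 0) v0.
by near=> n; rewrite u0 uv.
Unshelve. all: by end_near. Qed.

Lemma le0_cvg0 (x M : R) (v : nat -> R) : (forall n, x <= M + v n) ->
  v n @[n --> \oo] --> (0 : R) -> x <= M.
Proof.
move=> xv v0; have h : M + v n @[n --> \oo] --> M + 0 by apply: cvgD => //; exact: cvg_cst.
rewrite -(addr0 M) -(cvg_lim _ h) //; apply: limr_ge; first by apply/cvg_ex; exists (M + 0).
by near=> n; apply: xv.
Unshelve. all: by end_near. Qed.

Lemma cvg0D (u v : nat -> R) : u n @[n --> \oo] --> (0 : R) ->
  v n @[n --> \oo] --> (0 : R) -> u n + v n @[n --> \oo] --> (0 : R).
Proof. by move=> u0 v0; rewrite -[X in _ --> X]addr0; apply: cvgD. Qed.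

(** Convergence of a complex series is expressed by a sequence of real numbers,
    for which squeezing arguments are available. *)
Definition csum c l := nc (\sum_(i < n) c i - l) @[n --> \oo] --> (0 : R).

Lemma csum_unique c l k : csum c l -> csum c k -> l = k.
Proof.
move=> cl ck; apply/eqP; rewrite -subr_eq0; apply/eqP/nc_eq0/le_anti.
rewrite nc_ge0 andbT; have h := cvg0D cl ck.
apply: (le0_cvg0 _ h) => n; rewrite add0r -[X in _ <= X + _]ncN.
by apply: le_trans (ncD _ _); rewrite opprB addrA subrK.
Qed.

Lemma csum_ext c d l : c =1 d -> csum c l -> csum d l.
Proof.
by move=> cd; rewrite /csum; under eq_fun do under eq_bigr do rewrite cd.
Qed.

Lemma csumD c d l k : csum c l -> csum d k -> csum (fun n => c n + d n) (l + k).
Proof.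
move=> cl dk; have h := cvg0D cl dk.
apply: (cvg0_le _ _ h) => n; first exact: nc_ge0.
by rewrite big_split /= opprD addrACA; apply: ncD.
Qed.

Lemma csumZ c l k : csum c l -> csum (fun n => k * c n) (k * l).
Proof.
move=> cl; have h : nc k * nc (\sum_(i < n) c i - l) @[n --> \oo] --> nc k * 0.
  by apply: cvgM => //; exact: cvg_cst.
rewrite mulr0 in h; apply: (cvg0_le _ _ h) => n; first exact: nc_ge0.
by rewrite -mulr_sumr -mulrBr ncM.
Qed.

Lemma cvg_bounded0 (u : nat -> R) : u n @[n --> \oo] --> (0 : R) ->
  exists M, forall n, u n <= M.
Proof.
move=> u0; have /cvg_seq_bounded : cvgn u by apply/cvg_ex; exists 0.
by move=> /bounded_fun_has_ubound[M hM]; exists M => n; apply: hM; exists n.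
Qed.

Lemma csum_bounded c l : csum c l -> exists2 M, 0 <= M & forall n, nc (c n) <= M.
Proof.
move=> /[dup] cl /cvg_bounded0[M hM].
have M0 : 0 <= M by apply: le_trans (nc_ge0 _) (hM 0%N).
exists (M + M) => [|n]; first by rewrite addr_ge0.
have -> : c n = (\sum_(i < n.+1) c i - l) + - (\sum_(i < n) c i - l).
  by rewrite big_ord_recr /=; ring.
apply: le_trans (ncD _ _) _; rewrite ncN.
exact: lerD.
Qed.

Lemma geo_half n : \sum_(i < n) (2^-1 : R) ^+ i <= 2.
Proof.
suff -> : \sum_(i < n) (2^-1 : R) ^+ i = 2 - 2 * 2^-1 ^+ n.
  by rewrite lerBlDr lerDl mulr_ge0 // exprn_ge0 // invr_ge0.
elim: n => [|n IH]; first by rewrite big_ord0 expr0 mulr1 subrr.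
by rewrite big_ord_recr /= IH exprS; field.
Qed.

Lemma cvg_half (M : R) : M * 2^-1 ^+ n @[n --> \oo] --> (0 : R).
Proof.
rewrite -(mulr0 M); apply: cvgM; first exact: cvg_cst.
by apply: cvg_expr; rewrite ger0_norm ?invr_ge0 // invf_lt1 // ltr1n.
Qed.

Lemma csum_le c l (M : R) : (forall n, nc (c n) <= M * 2^-1 ^+ n) -> csum c l ->
  nc l <= M * 2.
Proof.
move=> cM cl.
have M0 : 0 <= M by have := le_trans (nc_ge0 _) (cM 0%N); rewrite expr0 mulr1.
apply: (le0_cvg0 _ cl) => n.
have -> : l = \sum_(i < n) c i - (\sum_(i < n) c i - l) by rewrite opprB addrC subrK.
apply: le_trans (ncD _ _) _; rewrite ncN opprB addrCA subrr addr0 lerD2r.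
apply: le_trans (nc_sum _ _) _.
apply: le_trans (_ : _ <= \sum_(i < n) M * 2^-1 ^+ i) _; first exact: ler_sum.
by rewrite -mulr_sumr ler_wpM2l // geo_half.
Qed.

(** Completeness of the complex numbers enters here, through the real and
    imaginary parts; it is what makes the differentiated series converge. *)
Lemma csum_exists c (M : R) : (forall n, nc (c n) <= M * 2^-1 ^+ n) ->
  exists l, csum c l.
Proof.
move=> cM.
have real_part (u : nat -> R) : (forall n, `|u n| <= nc (c n)) ->
    exists l : R, \sum_(i < n) u i @[n --> \oo] --> l.
  move=> uc; have : cvgn (series u).
    apply: normed_cvg.
    apply: (@series_le_cvg _ _ (fun n => M * 2^-1 ^+ n)) => n //=.
      by apply: le_trans (nc_ge0 _) (cM n).
    by apply: le_trans (cM n); exact: uc.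
    apply: is_cvg_geometric_series.
    by rewrite ger0_norm ?invr_ge0 // invf_lt1 // ltr1n.
  case/cvg_ex => l; rewrite /series /= => h; exists l.
  by under eq_fun do rewrite -(big_mkord xpredT u).
have [n|x hx] := real_part (fun n => complex.Re (c n)).
  by rewrite -lecR -nc_norm; exact: normc_ge_Re.
have [n|y hy] := real_part (fun n => complex.Im (c n)).
  rewrite -lecR -nc_norm; case: (c n) => a b /=.
  have := normc_ge_Re (b +i* a); rewrite /= /Normc.normc !normc_def /= addrC.
  by [].
exists (x +i* y).
have h : `|\sum_(i < n) complex.Re (c i) - x| + `|\sum_(i < n) complex.Im (c i) - y|
    @[n --> \oo] --> `|x - x| + `|y - y|.
  by apply: cvgD; apply: cvg_norm; apply: cvgB => //; exact: cvg_cst.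
rewrite !subrr !normr0 addr0 in h.
apply: (cvg0_le _ _ h) => n; first exact: nc_ge0.
have -> : \sum_(i < n) c i - (x +i* y)
    = (\sum_(i < n) complex.Re (c i) - x)%:C
      + 'i%C * (\sum_(i < n) complex.Im (c i) - y)%:C.
  rewrite !rmorphB !rmorph_sum /=.
  have -> : x +i* y = x%:C + 'i%C * y%:C by rewrite [LHS]complexE.
  rewrite mulrBr opprD addrACA; congr (_ + _); rewrite mulr_sumr -big_split /=.
  by apply: eq_bigr => i _; rewrite [LHS]complexE.
apply: le_trans (ncD _ _) _; rewrite ncM.
have ncR (t : R) : nc t%:C = `|t|.
  by rewrite /Normc.normc /= expr0n /= addr0 sqrtr_sqr.
by rewrite !ncR /Normc.normc /= expr0n expr1n add0r sqrtr1 mul1r.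
Qed.
End ComplexSeries.

(** * Entire functions and their power series *)

Section Entire.
Variable R : realType.
Implicit Types (a b : fps R[i]) (f g : R[i] -> R[i]) (z h : R[i]).
Local Open Scope classical_set_scope.
Local Notation nc := (@Normc.normc R).

(** f is entire, with Taylor series a at 0. *)
Definition represents a f := forall z, csum (fun n => a n * z ^+ n) (f z).

Lemma represents_at0 a f : represents a f -> f 0 = a 0%N.
Proof.
move=> af; apply: csum_unique (af 0) _.
have e n : (0 < n)%N -> \sum_(i < n) a i * (0 : R[i]) ^+ i = a 0%N.
  case: n => // n _; rewrite big_ord_recl expr0 mulr1 big1 ?addr0 // => i _.
  by rewrite exprS mul0r mulr0.
apply: (@cvg_trans _ ((fun=> 0 : R) @ \oo)); last exact: cvg_cst.
apply: near_eq_cvg; near=> n; rewrite e ?subrr ?Normc.normc0 //.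
by near: n; exact: nbhs_infty_gt.
Unshelve. all: by end_near. Qed.

Lemma representsC (k : R[i]) : represents (fpsC k) (fun=> k).
Proof.
move=> z; apply: (@cvg_trans _ ((fun=> 0 : R) @ \oo)); last exact: cvg_cst.
apply: near_eq_cvg; near=> n.
have -> : n = n.-1.+1 by rewrite prednK //; near: n; exact: nbhs_infty_gt.
rewrite big_ord_recl /= !expr0 mulr1 big1 ?addr0 ?subrr ?Normc.normc0 // => i _.
by rewrite mul0r.
Unshelve. all: by end_near. Qed.

Lemma represents_fun a f g : represents a f -> represents a g -> f = g.
Proof. by move=> af ag; apply: funext => z; apply: csum_unique (af z) (ag z). Qed.

Lemma representsD a b f g : represents a f -> represents b g ->
  represents (a + b) (fun z => f z + g z).
Proof.
move=> af bg z; apply: csum_ext (csumD (af z) (bg z)) => n.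
by rewrite coef_fpsD mulrDl.
Qed.

Lemma representsZ (k : R[i]) a f : represents a f ->
  represents (fpsC k * a) (fun z => k * f z).
Proof.
move=> af z; apply: csum_ext (csumZ k (af z)) => n.
by rewrite coef_fpsCM mulrA.
Qed.

Lemma representsN a f : represents a f -> represents (- a) (fun z => - f z).
Proof.
move=> af z; rewrite -[- f z]mulN1r; apply: csum_ext (csumZ (-1) (af z)) => n.
by rewrite coef_fpsN mulN1r mulNr.
Qed.

Lemma represents_scale (m : R[i]) a f : represents a f ->
  represents (fps_scale idfun m a) (fun z => f (m * z)).
Proof.
move=> af z; apply: csum_ext (af (m * z)) => n.
by rewrite /= exprMn mulrA.
Qed.

(** Evaluation at r, where the terms are bounded, gives geometric decay of any
    ratio. *)
Lemma represents_decay a f (r : R) : represents a f -> 0 <= r ->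
  exists2 M, 0 <= M & forall n, nc (a n) * r ^+ n <= M.
Proof.
move=> af r0; have [M M0 hM] := csum_bounded (af r%:C); exists M => // n.
by have := hM n; rewrite ncM ncX nc_real.
Qed.

(** Cauchy product: the product of two N-th partial sums and the N-th partial
    sum of the product differ by the terms of degree N to 2N - 1 of a product
    of polynomials, which are O(2^-N) in total because the coefficients decay
    like r^-n with r at least 4 times the modulus of z. *)
Lemma representsM a b f g : represents a f -> represents b g ->
  represents (a * b) (fun z => f z * g z).
Proof.
move=> af bg z.
pose r := 4 * (nc z + 1); have z0 := nc_ge0 z.
have r0 : 0 <= r by rewrite mulr_ge0 // addr_ge0.
have [M M0 hM] := represents_decay af r0.
have [M' M'0 hM'] := represents_decay bg r0.
pose S N := \sum_(i < N) a i * z ^+ i; pose T N := \sum_(i < N) b i * z ^+ i.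
pose p N : {poly R[i]} := \poly_(i < N) a i; pose q N : {poly R[i]} := \poly_(i < N) b i.
have pS N : (p N).[z] = S N by rewrite horner_poly.
have qT N : (q N).[z] = T N by rewrite horner_poly.
have cpq N n : nc ((p N * q N)`_n * z ^+ n) <= M * M' * 2^-1 ^+ n.
  have r4 : nc z ^+ n <= r ^+ n * 4^-1 ^+ n.
    rewrite -exprMn; apply: lerXn2r; rewrite ?nnegrE ?nc_ge0 ?mulr_ge0 ?invr_ge0 ?addr_ge0 //.
    by rewrite /r mulrC mulrA mulVf ?mul1r ?lerDl ?pnatr_eq0.
  have cr : nc (p N * q N)`_n * r ^+ n <= (2 ^ n)%:R * (M * M').
    apply: le_trans (_ : (n.+1)%:R * (M * M') <= _); last first.
      by rewrite ler_wpM2r ?mulr_ge0 // ler_nat ltn_expl.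
    rewrite coefM mulr_natl -[X in _ *+ X]card_ord -sumr_const.
    apply: le_trans (ler_wpM2r (exprn_ge0 n r0) (nc_sum (fun i => (p N)`_i * (q N)`_(n - i)) n.+1)) _.
    rewrite mulr_suml; apply: ler_sum => i _.
    have -> : r ^+ n = r ^+ i * r ^+ (n - i) by rewrite -exprD subnKC // -ltnS.
    rewrite ncM mulrACA; apply: ler_pM; rewrite ?mulr_ge0 ?nc_ge0 ?exprn_ge0 //.
      by rewrite coef_poly; case: ifP => // _; rewrite Normc.normc0 mul0r.
    by rewrite coef_poly; case: ifP => // _; rewrite Normc.normc0 mul0r.
  rewrite ncM ncX; apply: le_trans (ler_wpM2l (nc_ge0 _) r4) _.
  rewrite mulrA; apply: le_trans (ler_wpM2r _ cr) _; first by rewrite exprn_ge0 ?invr_ge0.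
  rewrite natrX mulrAC -exprMn mulrC; have -> : 2 * 4^-1 = 2^-1 :> R by field.
  by [].
have diff N : nc (S N * T N - \sum_(i < N) (a * b) i * z ^+ i)
    <= M * M' * 2 * 2^-1 ^+ N.
  have sz : (size (p N * q N)%R <= N + N)%N.
    apply: leq_trans (size_polyMleq _ _) _.
    by apply: leq_trans (leq_pred _) (leq_add _ _); exact: size_poly.
  rewrite -pS -qT -hornerM (horner_coef_wide _ sz) big_split_ord /=.
  have -> : \sum_(i < N) (p N * q N)`_i * z ^+ i = \sum_(i < N) (a * b) i * z ^+ i.
    apply: eq_bigr => i _; congr (_ * _).
    have pa j : (j <= i)%N -> (p N)`_j = a j.
      by move=> ji; rewrite coef_poly (leq_ltn_trans ji (ltn_ord i)).
    have qb j : (j <= i)%N -> (q N)`_j = b j.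
      by move=> ji; rewrite coef_poly (leq_ltn_trans ji (ltn_ord i)).
    by rewrite -(fps_mul_poly pa qb).
  rewrite addrAC subrr add0r.
  apply: le_trans (nc_sum (fun i => (p N * q N)`_(N + i) * z ^+ (N + i)) N) _.
  apply: le_trans (_ : _ <= \sum_(i < N) M * M' * 2^-1 ^+ N * 2^-1 ^+ i) _.
    by apply: ler_sum => i _; apply: le_trans (cpq _ _) _; rewrite exprD mulrA.
  rewrite -mulr_sumr [X in _ <= X]mulrAC.
  by rewrite ler_wpM2l ?mulr_ge0 ?exprn_ge0 ?invr_ge0 // geo_half.
have [B B0 hB] : exists2 B, 0 <= B & forall N, nc (S N) <= B.
  have [B hB] := cvg_bounded0 (af z); exists (B + nc (f z)).
    by rewrite addr_ge0 ?nc_ge0 // (le_trans (nc_ge0 _) (hB 0%N)).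
  move=> N; rewrite -[S N](subrK (f z)); apply: le_trans (ncD _ _) _.
  by rewrite lerD2r; exact: hB.
have h1 : B * nc (T N - g z) @[N --> \oo] --> (0 : R).
  by rewrite -[X in _ --> X](mulr0 B); apply: cvgM (bg z); exact: cvg_cst.
have h2 : nc (g z) * nc (S N - f z) @[N --> \oo] --> (0 : R).
  by rewrite -[X in _ --> X](mulr0 (nc (g z))); apply: cvgM (af z); exact: cvg_cst.
have h := cvg0D (cvg0D h1 h2) (cvg_half (R := R) (M * M' * 2)).
apply: (cvg0_le _ _ h) => N; first exact: nc_ge0.
have -> : \sum_(i < N) (a * b) i * z ^+ i - f z * g z =
    S N * (T N - g z) + g z * (S N - f z)
    + - (S N * T N - \sum_(i < N) (a * b) i * z ^+ i) by ring.
apply: le_trans (ncD _ _) _; rewrite ncN; apply: lerD (diff N).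
apply: le_trans (ncD _ _) _; rewrite !ncM lerD2r ler_wpM2r ?nc_ge0 //.
Qed.

Lemma representsX a f n : represents a f -> represents (a ^+ n) (fun z => f z ^+ n).
Proof.
move=> af; elim: n => [|n IH]; first by rewrite expr0; exact: representsC.
have -> : (fun z => f z ^+ n.+1) = (fun z => f z * f z ^+ n).
  by apply: funext => z; rewrite exprS.
by rewrite exprS; exact: representsM.
Qed.

Lemma representsMn (n : nat) a f :
  represents a f -> represents (n%:R * a) (fun z => n%:R * f z).
Proof.
move=> af; have -> : n%:R * a = fpsC (n%:R : R[i]) * a; last exact: representsZ.
congr (_ * _); elim: n => [|n IH]; first by apply: fpsP => -[|n].
by rewrite -natr1 IH; apply: fpsP => -[|m]; rewrite coef_fpsD /= -?natr1 ?addr0.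
Qed.

End Entire.

Section EntireDerivative.
Variable R : realType.
Implicit Types (a b : fps R[i]) (f g : R[i] -> R[i]) (z h : R[i]).
Local Open Scope classical_set_scope.
Local Notation nc := (@Normc.normc R).

Lemma csum_shift (c : nat -> R[i]) l : c 0%N = 0 ->
  csum (fun n => c n.+1) l -> csum c l.
Proof.
rewrite /csum => c0 cl; rewrite -cvg_shiftS.
by under eq_fun do rewrite big_ord_recl c0 add0r /=.
Qed.

(** Induction on n: the remainder e_n satisfies
    e_(n+1) = (z + h) e_n + n h^2 z^(n-1). *)
Lemma pow_taylor2 z h n : nc h <= 1 ->
  nc ((z + h) ^+ n - z ^+ n - h * (n%:R * z ^+ n.-1))
    <= (n ^ 2)%:R * (nc z + 1) ^+ n * nc h ^+ 2.
Proof.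
move=> h1; have z0 := nc_ge0 z; have h0 := nc_ge0 h.
have r1 : 1 <= nc z + 1 by rewrite lerDr.
elim: n => [|n IH].
  by rewrite !expr0 subrr mul0r mulr0 subr0 Normc.normc0 !mul0r.
have -> : (z + h) ^+ n.+1 - z ^+ n.+1 - h * (n.+1%:R * z ^+ n) =
    (z + h) * ((z + h) ^+ n - z ^+ n - h * (n%:R * z ^+ n.-1))
    + h ^+ 2 * (n%:R * z ^+ n.-1).
  rewrite -natr1 !exprS; case: n {IH} => [|n] /=; first by rewrite !expr0; ring.
  by rewrite !exprS; ring.
apply: le_trans (ncD _ _) _; rewrite !ncM !ncX nc_nat.
have e1 : nc (z + h) * nc ((z + h) ^+ n - z ^+ n - h * (n%:R * z ^+ n.-1)) <=
    (nc z + 1) * ((n ^ 2)%:R * (nc z + 1) ^+ n * nc h ^+ 2).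
  apply: ler_pM IH; rewrite ?nc_ge0 //.
  by apply: le_trans (ncD _ _) _; rewrite lerD2l.
have e2 : nc h ^+ 2 * (n%:R * nc z ^+ n.-1) <= nc h ^+ 2 * (n%:R * (nc z + 1) ^+ n.+1).
  rewrite ler_wpM2l ?exprn_ge0 // ler_wpM2l //.
  apply: le_trans (_ : (nc z + 1) ^+ n.-1 <= _).
    by apply: lerXn2r; rewrite ?nnegrE ?addr_ge0 // lerDl.
  by apply: ler_weXn2l => //; lia.
apply: le_trans (lerD e1 e2) _.
have -> : (nc z + 1) * ((n ^ 2)%:R * (nc z + 1) ^+ n * nc h ^+ 2) +
    nc h ^+ 2 * (n%:R * (nc z + 1) ^+ n.+1) =
    (n ^ 2 + n)%:R * (nc z + 1) ^+ n.+1 * nc h ^+ 2 by rewrite natrD [(nc z + 1) ^+ n.+1]exprS; ring.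
rewrite -!mulrA ler_wpM2r ?mulr_ge0 ?exprn_ge0 ?addr_ge0 // ler_nat.
lia.
Qed.

(** Summing the second-order Taylor estimate of the powers.  The constant 8
    absorbs the factor n^2, at most 4^n, and leaves the ratio 1/2. *)
Lemma represents_deriv_estimate a f : represents a f ->
  exists2 f' : R[i] -> R[i], represents (fpsD a) f' &
    forall z, exists M : R, forall h, nc h <= 1 ->
      nc (f (z + h) - f z - h * f' z) <= M * nc h ^+ 2.
Proof.
move=> af.
have decay z : exists2 M, 0 <= M & forall n,
    nc (a n) * (n ^ 2)%:R * (nc z + 1) ^+ n <= M * 2^-1 ^+ n.
  have z0 := nc_ge0 z.
  have r0 : 0 <= 8 * (nc z + 1) by rewrite mulr_ge0 // addr_ge0.
  have [M M0 hM] := represents_decay af r0.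
  exists M => // n.
  have e : (n ^ 2)%:R <= (4 : R) ^+ n.
    rewrite -natrX ler_nat (_ : 4 = 2 ^ 2)%N // -expnM mulnC expnM.
    by rewrite leq_exp2r // ltnW // ltn_expl.
  rewrite -mulrA; apply: le_trans (ler_wpM2l (nc_ge0 _) (ler_wpM2r _ e)) _.
    by rewrite exprn_ge0 // addr_ge0.
  have -> : 4 ^+ n * (nc z + 1) ^+ n = (8 * (nc z + 1)) ^+ n * 2^-1 ^+ n.
    by rewrite -!exprMn; congr (_ ^+ n); field.
  by rewrite mulrA ler_wpM2r // exprn_ge0 // invr_ge0.
have /choice[f' hf'] z : exists l, csum (fun n => fpsD a n * z ^+ n) l.
  have z0 := nc_ge0 z; have [M M0 hM] := decay z.
  apply: (@csum_exists _ _ M) => n.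
  have -> : fpsD a n * z ^+ n = a n.+1 * n.+1%:R * z ^+ n by rewrite mulr_natr.
  rewrite !ncM ncX nc_nat; apply: le_trans (_ : _ <= M * 2^-1 ^+ n.+1) _.
    apply: le_trans (hM n.+1); apply: ler_pM; rewrite ?mulr_ge0 ?nc_ge0 ?exprn_ge0 //.
      by rewrite ler_wpM2l ?nc_ge0 // ler_nat; lia.
    apply: le_trans (_ : (nc z + 1) ^+ n <= _).
      by apply: lerXn2r; rewrite ?nnegrE ?addr_ge0 // lerDl.
    by apply: ler_weXn2l => //; rewrite lerDr.
  rewrite ler_wpM2l // exprS ler_piMl ?exprn_ge0 ?invr_ge0 //.
  by rewrite invf_le1 // ler1n.
exists f' => // z; have [M M0 hM] := decay z.
exists (M * 2) => h h1.
have s3 : csum (fun n => a n * (n%:R * z ^+ n.-1)) (f' z).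
  apply: csum_shift; first by rewrite mul0r mulr0.
  by apply: csum_ext (hf' z) => n; rewrite /= mulrA mulr_natr.
have s := csumD (csumD (af (z + h)) (csumZ (-1) (af z))) (csumZ (- h) s3).
rewrite !mulN1r mulNr in s.
have h0 := nc_ge0 h.
have : nc (f (z + h) - f z - h * f' z) <= M * nc h ^+ 2 * 2.
  apply: csum_le s => n.
  have -> : a n * (z + h) ^+ n + -1 * (a n * z ^+ n) + - h * (a n * (n%:R * z ^+ n.-1))
     = a n * ((z + h) ^+ n - z ^+ n - h * (n%:R * z ^+ n.-1)) by ring.
  rewrite ncM; apply: le_trans (ler_wpM2l (nc_ge0 _) (pow_taylor2 z n h1)) _.
  by rewrite mulrA [X in _ <= X]mulrAC ler_wpM2r ?exprn_ge0 // mulrA.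
by rewrite [M * 2 * _]mulrAC.
Qed.

Lemma represents_deriv a f : represents a f ->
  exists2 f' : R[i] -> R[i], represents (fpsD a) f' &
    forall z, is_derive (z : R[i]^o) 1 (f : R[i]^o -> R[i]^o) (f' z).
Proof.
move=> /represents_deriv_estimate[f' af' est]; exists f' => // z.
have [M hM] := est z.
have lim : h^-1 *: (((f : R[i]^o -> R[i]^o) \o shift z) (h *: (1 : R[i]^o)) - f z)
    @[h --> (0 : R[i]^o)^'] --> (f' z : R[i]^o).
  apply/cvgrPdist_lt => e e0.
  have eR : e = (nc e)%:C by rewrite -nc_norm gtr0_norm.
  have e0' : 0 < nc e by rewrite -ltcR -eR.
  pose d := Num.min 1 (nc e / (`|M| + 1)).
  have d0 : 0 < d by rewrite lt_min ltr01 divr_gt0 // ltr_wpDl.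
  exists d%:C => /=; first by rewrite ltcR.
  move=> h /=; rewrite sub0r normrN nc_norm ltcR lt_min => /andP[h1 h2] hn0.
  rewrite nc_norm eR ltcR.
  have hnc : 0 < nc h.
    by rewrite lt_neqAle nc_ge0 andbT eq_sym; apply: contra hn0 => /eqP/nc_eq0 ->.
  rewrite -(ltr_pM2l hnc) -ncM.
  have -> : h * (f' z - h^-1 * (f (h * 1 + z) - f z)) = - (f (z + h) - f z - h * f' z).
    by rewrite mulr1 [h + z]addrC; field.
  rewrite ncN; apply: le_lt_trans (hM h (ltW h1)) _.
  rewrite expr2 mulrCA ltr_pM2l //; apply: le_lt_trans (_ : (`|M| + 1) * nc h < _).
    by rewrite ler_wpM2r ?nc_ge0 // (le_trans (ler_norm M)) // lerDl.
  by rewrite mulrC -ltr_pdivlMr // ltr_wpDl.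
apply: DeriveDef; first by apply/cvg_ex; exists (f' z).
exact: cvg_lim lim.
Qed.

(** If f vanishes identically, so do its derivatives, whose values at 0 are the
    coefficients up to factorials. *)
Lemma represents_inj a b f : represents a f -> represents b f -> a = b.
Proof.
move=> af bf; apply/eqP; rewrite -subr_eq0; apply/eqP.
have := representsD af (representsN bf).
have -> : (fun z => f z - f z) = (fun=> 0) by apply: funext => z; rewrite subrr.
move: (a - b) => {af bf}d; suff zero n : forall e : fps R[i], represents e (fun=> 0) -> e n = 0.
  by move=> d0; apply: fpsP => n; apply: zero.
elim: n => [|n IH] {}d d0; first by rewrite -(represents_at0 d0).
have [f' df' f'E] := represents_deriv d0.
have f'0 : f' = (fun=> 0).
  apply: funext => z; have := f'E z.
  by case=> _ <-; rewrite derive_cst.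
move: df'; rewrite f'0 => /IH /= /eqP.
by rewrite -mulr_natr mulf_eq0 pnatr_eq0 orbF => /eqP.
Qed.
End EntireDerivative.

(** * Identities for the Weierstrass sigma function *)

Section Sigma.
Variables (R : realType) (g2 g3 : R[i]) (sigma : R[i] -> R[i]).
Hypothesis hsigma : weierstrass_sigma g2 g3 sigma.
Local Open Scope classical_set_scope.
Local Notation nc := (@Normc.normc R).

Lemma sigma_series : exists2 s : fps R[i], represents s sigma &
  [/\ s 0%N = 0, s 1%N = 1 & s 2%N = 0].
Proof.
case: hsigma => -[a [a0 a1 a2 aE]] _; exists (Fps a) => // z.
apply/cvgrPdist_lt => e e0.
have /cvgrPdist_lt/(_ e%:C) := aE z; rewrite ltcR => /(_ e0).
apply: filterS => n; rewrite nc_norm ltcR -ncN opprB /series /= big_mkord.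
by rewrite sub0r normrN ger0_norm ?nc_ge0.
Qed.

Lemma is_derive_quot (f g : R[i]^o -> R[i]^o) (z f' g' : R[i]^o) :
  g z != 0 -> is_derive z 1 f f' -> is_derive z 1 g g' ->
  is_derive z 1 (fun y => f y / g y) ((f' * g z - f z * g') / g z ^+ 2).
Proof.
move=> gz hf hg.
have hV : is_derive z 1 (fun y => (g y)^-1) (- g z ^- 2 *: g').
  have [dg <-] := hg.
  by apply: DeriveDef; [exact: derivableV | rewrite deriveV].
have := is_deriveM hf hV.
set F := f * _; have -> : F = (fun y => f y / g y) by [].
move=> h; apply: is_derive_eq h _.
by rewrite /GRing.scale /=; field.
Qed.

(** Multiplied by sigma^6, the differential equation of wp holds also at the
    zeros of sigma, where both sides are 4 sigma'^6.  Both sides being entire,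
    it is then an identity between power series. *)
Lemma sigma_ode (s : fps R[i]) : represents s sigma ->
  let s1 := fpsD s in let s2 := fpsD s1 in let s3 := fpsD s2 in
  (3 * s * s1 * s2 - s ^+ 2 * s3 - 2 * s1 ^+ 3) ^+ 2 =
  4 * sigma2wp s ^+ 3 - fpsC g2 * sigma2wp s * s ^+ 4 - fpsC g3 * s ^+ 6.
Proof.
move=> ss s1 s2 s3.
have [f1 ss1 d1] := represents_deriv ss.
have [f2 ss2 d2] := represents_deriv ss1.
have [f3 ss3 d3] := represents_deriv ss2.
pose Bf z := f1 z ^+ 2 - sigma z * f2 z.
pose Cf z := 3 * sigma z * f1 z * f2 z - sigma z ^+ 2 * f3 z - 2 * f1 z ^+ 3.
have zetaE : zeta_of sigma = (fun z => f1 z / sigma z).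
  apply: funext => z; rewrite /zeta_of derive1E.
  by have [_ ->] := d1 z.
have wpE z : sigma z != 0 -> wp_of sigma z = Bf z / sigma z ^+ 2.
  move=> sz; rewrite /wp_of zetaE derive1E.
  have [_ ->] := is_derive_quot sz (d2 z) (d1 z).
  by rewrite /Bf; field.
have wp'E z : sigma z != 0 -> derive1 (wp_of sigma) z = Cf z / sigma z ^+ 3.
  move=> sz.
  have near_wp : \forall y \near (z : R[i]^o), Bf y / sigma y ^+ 2 = wp_of sigma y.
    have cs : {for (z : R[i]^o), continuous (sigma : R[i]^o -> R[i]^o)}.
      apply: differentiable_continuous; apply/derivable1_diffP.
      by have [] := d1 z.
    near=> y; rewrite wpE //; near: y.
    exact: (@cvgr_neq0 _ _ _ _ _ _ _ cs sz).
  have dB : is_derive (z : R[i]^o) 1 (Bf : R[i]^o -> R[i]^o)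
     (f1 z * f2 z - sigma z * f3 z).
    have h := is_deriveB (is_deriveM (d2 z) (d2 z)) (is_deriveM (d1 z) (d3 z)).
    set F := (X in is_derive _ _ X _) in h.
    have -> : (Bf : R[i]^o -> R[i]^o) = F by [].
    apply: is_derive_eq h _; rewrite /GRing.scale /=; ring.
  have dS : is_derive (z : R[i]^o) 1 ((fun y => sigma y ^+ 2) : R[i]^o -> R[i]^o)
     (2 * sigma z * f1 z).
    have h := is_deriveM (d1 z) (d1 z).
    apply: is_derive_eq h _; rewrite /GRing.scale /=; ring.
  have sz2 : sigma z ^+ 2 != 0 by rewrite expf_neq0.
  have dQ := @is_derive_quot Bf (fun y => sigma y ^+ 2) z _ _ sz2 dB dS.
  have [_] := @near_eq_is_derive _ R[i]^o R[i]^o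
    (fun y => Bf y / sigma y ^+ 2) (wp_of sigma) z 1 _ near_wp dQ.
  rewrite derive1E => ->; rewrite /Bf /Cf; field.
  by [].
have odeE z : Cf z ^+ 2 =
    4 * Bf z ^+ 3 - g2 * Bf z * sigma z ^+ 4 - g3 * sigma z ^+ 6.
  have [s0|sz] := eqVneq (sigma z) 0; first by rewrite /Cf /Bf s0; ring.
  have := hsigma.2 z sz; rewrite wp'E // wpE // => E.
  have {E} : (Cf z / sigma z ^+ 3) ^+ 2 * sigma z ^+ 6 = (4 * (Bf z / sigma z ^+ 2) ^+ 3
       - g2 * (Bf z / sigma z ^+ 2) - g3) * sigma z ^+ 6 by rewrite E.
  have -> : (Cf z / sigma z ^+ 3) ^+ 2 * sigma z ^+ 6 = Cf z ^+ 2 by field.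
  by move=> ->; field.
have rB : represents (sigma2wp s) Bf.
  exact: representsD (representsX 2 ss1) (representsN (representsM ss ss2)).
have rC : represents (3 * s * s1 * s2 - s ^+ 2 * s3 - 2 * s1 ^+ 3) Cf.
  apply: representsD; first apply: representsD.
  - by do 2!apply: representsM => //; exact: representsMn.
  - by apply: representsN; apply: representsM => //; exact: representsX.
  - by apply: representsN; apply: representsMn; exact: representsX.
apply: (@represents_inj _ _ _ (fun z => Cf z ^+ 2)); first exact: representsX.
have -> : (fun z => Cf z ^+ 2) =
    (fun z => 4 * Bf z ^+ 3 - g2 * Bf z * sigma z ^+ 4 - g3 * sigma z ^+ 6).
  exact: funext.
apply: representsD; first apply: representsD.
- by apply: representsMn; exact: representsX.
- by apply: representsN; apply: representsM; [exact: representsZ|exact: representsX].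
- by apply: representsN; apply: representsZ; exact: representsX.
Unshelve. all: by end_near. Qed.

(** The formula wp(y) - wp(x) = sigma(x + y) sigma(x - y) / (sigma(x)^2
    sigma(y)^2) without denominators, B being sigma^2 wp.  The formal identity is
    applied with lambda = y / x, hence the restriction on x. *)
Lemma sigma_duplication_neq0 : exists B : R[i] -> R[i], B 0 = 1 /\
  forall x y, x != 0 ->
    sigma (x + y) * sigma (x - y) = sigma x ^+ 2 * B y - B x * sigma y ^+ 2.
Proof.
have [s ss [s0 s1 s2]] := sigma_series.
have [f1 ss1 _] := represents_deriv ss.
have [f2 ss2 _] := represents_deriv ss1.
pose Bf z := f1 z ^+ 2 - sigma z * f2 z.
have rB : represents (sigma2wp s) Bf.
  rewrite /sigma2wp expr2.
  exact: representsD (representsM ss1 ss1) (representsN (representsM ss ss2)).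
have rA : represents (s ^+ 2) (fun z => sigma z ^+ 2) by rewrite expr2; exact: representsM.
exists Bf; split.
  rewrite (represents_at0 rB) /sigma2wp coef_fpsD coef_fpsN expr2 !coef_fpsM !big_ord1.
  by rewrite s0 mul0r subr0 /= s1 mulr1.
move=> x y x0; pose l := y / x.
have E := duplication_scaled s0 s1 s2 (sigma_ode ss) l.
have L := representsM (represents_scale (1 + l) ss) (represents_scale (1 - l) ss).
have D := representsD (representsM rA (represents_scale l rB))
  (representsN (representsM rB (represents_scale l rA))).
rewrite E in L; have := congr1 (fun f => f x) (represents_fun L D).
have -> : (1 + l) * x = x + y by rewrite /l; field.
have -> : (1 - l) * x = x - y by rewrite /l; field.
by have -> : l * x = y by rewrite /l; field.
Qed.

Lemma sigma0 : sigma 0 = 0.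
Proof. by have [s ss [s0 _ _]] := sigma_series; rewrite (represents_at0 ss). Qed.

(** The right side of the duplication formula is antisymmetric in x and y; the
    left side becomes sigma(c) sigma(- d) instead of sigma(c) sigma(d) when x
    and y are exchanged, with x + y = c and x - y = d. *)
Lemma sigma_odd c d : sigma c != 0 -> c + d != 0 -> c - d != 0 ->
  sigma (- d) = - sigma d.
Proof.
move=> sc cd1 cd2; have [B [_ BE]] := sigma_duplication_neq0.
have two0 : (2 : R[i]) != 0 by rewrite pnatr_eq0.
pose x := (c + d) / 2; pose y := (c - d) / 2.
have x0 : x != 0 by rewrite mulf_neq0 ?invr_eq0.
have y0 : y != 0 by rewrite mulf_neq0 ?invr_eq0.
have e1 := BE x y x0; have e2 := BE y x y0.
have h1 : x + y = c by rewrite /x /y; field.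
have h2 : x - y = d by rewrite /x /y; field.
rewrite [y + x]addrC h1 -[y - x]opprB h2 in e2; rewrite h1 h2 in e1.
apply: (mulfI sc); rewrite e2 mulrN e1; ring.
Qed.

(* Two auxiliary points are needed because sigma_odd excludes d = c and d = - c. *)
Hypothesis nonzero : exists2 c, sigma c != 0 & sigma (2 * c) != 0.

Lemma sigmaN d : sigma (- d) = - sigma d.
Proof.
have [c c1 c2] := nonzero.
have c0 : c != 0 by apply: contraNneq c1 => ->; rewrite sigma0.
have [dc|nd] := boolP ((d == c) || (d == - c)); last first.
  move: nd; rewrite negb_or => /andP[n1 n2]; apply: sigma_odd c1 _ _.
    by rewrite addrC addr_eq0.
  by rewrite subr_eq0 eq_sym.
have e3 : 2 * c + c != 0.
  by have -> : 2 * c + c = 3 * c; [ring | rewrite mulf_neq0 ?pnatr_eq0].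
have e1 : 2 * c - c != 0 by have -> : 2 * c - c = c by ring.
by apply: sigma_odd c2 _ _; case/orP: dc => /eqP ->; rewrite ?opprK.
Qed.

Lemma sigma_duplication : exists B : R[i] -> R[i], forall x y,
  sigma (x + y) * sigma (x - y) = sigma x ^+ 2 * B y - B x * sigma y ^+ 2.
Proof.
have [B [B0 BE]] := sigma_duplication_neq0; exists B => x y.
have [->|] := eqVneq x 0; last exact: BE.
rewrite add0r sub0r sigmaN sigma0 B0; ring.
Qed.

(** Weierstrass's three-term identity.  The products are of the form
    f(x, y) = sigma(x + y) sigma(x - y), which is a two by two determinant
    in (sigma^2, B) by the duplication formula; the identity is the Pluecker
    relation for the four points p + B, p + A, p, q with p = (a + b) / 2 and
    q = (a - b) / 2. *)
Lemma sigma_three_term a b A B :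
  sigma a * sigma b * sigma (B - A) * sigma (a + b + A + B) =
  sigma B * sigma (a + b + B) * sigma (a + A) * sigma (b + A)
  - sigma A * sigma (a + b + A) * sigma (a + B) * sigma (b + B).
Proof.
have [W WE] := sigma_duplication.
pose p := (a + b) / 2; pose q := (a - b) / 2.
have W' u v x y : x + y = u -> x - y = v ->
    sigma u * sigma v = sigma x ^+ 2 * W y - W x * sigma y ^+ 2.
  by move=> <- <-.
have -> : sigma a * sigma b * sigma (B - A) * sigma (a + b + A + B) =
  (sigma a * sigma b) * (sigma (a + b + A + B) * sigma (B - A)) by ring.
have -> : sigma B * sigma (a + b + B) * sigma (a + A) * sigma (b + A) =
  (sigma (a + b + B) * sigma B) * (sigma (a + A) * sigma (b + A)) by ring.
have -> : sigma A * sigma (a + b + A) * sigma (a + B) * sigma (b + B) =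
  (sigma (a + b + A) * sigma A) * (sigma (a + B) * sigma (b + B)) by ring.
rewrite (W' a b p q) ?(W' (a + b + A + B) (B - A) (p + B) (p + A))
  ?(W' (a + b + B) B (p + B) p) ?(W' (a + A) (b + A) (p + A) q)
  ?(W' (a + b + A) A (p + A) p) ?(W' (a + B) (b + B) (p + B) q);
  by rewrite /p /q; field.
Qed.

End Sigma.

(** * Orthogonal polynomials and the umbral derivative *)

Section Orthogonal.
Variables (R : realType) (m : nat -> R[i]).
Implicit Types (p q r : {poly R[i]}) (P : nat -> {poly R[i]}).
Local Notation L := (functional_of_moments m).

Lemma functional_widen p n : (size p <= n)%N -> L p = \sum_(i < n) p`_i * m i.
Proof.
move=> pn; rewrite /functional_of_moments (big_ord_widen n (fun i => p`_i * m i) pn).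
rewrite big_mkcond /=; apply: eq_bigr => i _; case: ltnP => // ni.
by rewrite nth_default ?mul0r.
Qed.

Lemma functionalD p q : L (p + q) = L p + L q.
Proof.
pose n := maxn (size p) (size q).
rewrite (@functional_widen p n) ?leq_maxl // (@functional_widen q n) ?leq_maxr //.
rewrite (@functional_widen _ n) ?size_polyD // -big_split /=.
by apply: eq_bigr => i _; rewrite coefD mulrDl.
Qed.

Lemma functionalZ c p : L (c *: p) = c * L p.
Proof.
rewrite (functional_widen (size_scale_leq c p)) mulr_sumr.
by apply: eq_bigr => i _; rewrite coefZ mulrA.
Qed.

Lemma functionalB p q : L (p - q) = L p - L q.
Proof. by rewrite functionalD -scaleN1r functionalZ mulN1r. Qed.

Lemma functional0 : L 0 = 0.
Proof. by rewrite -(scale0r 0) functionalZ mul0r. Qed.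

Lemma functional_sum (I : Type) (s : seq I) (F : I -> {poly R[i]}) :
  L (\sum_(i <- s) F i) = \sum_(i <- s) L (F i).
Proof. exact: (big_morph _ functionalD functional0). Qed.

Lemma functionalXn n : L 'X^n = m n.
Proof.
rewrite /functional_of_moments size_polyXn big_ord_recr /= coefXn eqxx mul1r.
rewrite big1 ?add0r // => i _; rewrite coefXn ltn_eqF ?mul0r //.
Qed.

Lemma functionalMXn p n k : (size p <= n)%N ->
  L (p * 'X^k) = \sum_(i < n) p`_i * m (i + k)%N.
Proof.
move=> pn; rewrite -{1}(coefK p) poly_def mulr_suml functional_sum.
rewrite (big_ord_widen n (fun i => L (p`_i *: 'X^i * 'X^k)) pn) big_mkcond /=.
apply: eq_bigr => i _; rewrite -scalerAl -exprD functionalZ functionalXn.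
by case: ltnP => // le_pi; rewrite nth_default ?mul0r.
Qed.

Definition orth_below n p := forall k, (k < n)%N -> L (p * 'X^k) = 0.

Lemma orth_belowP n p q : orth_below n p -> (size q <= n)%N -> L (p * q) = 0.
Proof.
move=> op qn; rewrite -(coefK q) poly_def mulr_sumr functional_sum big1 // => i _.
by rewrite -scalerAr functionalZ op ?mulr0 // (leq_trans (ltn_ord i)).
Qed.

Local Notation H n := (\matrix_(i < n, k < n) m (i + k)%N).

Lemma hankel_rVpoly n (c : 'rV[R[i]]_n) (k : 'I_n) :
  (c *m H n) ord0 k = L (rVpoly c * 'X^k).
Proof.
rewrite (@functionalMXn _ n) ?size_poly // mxE.
by apply: eq_bigr => i _; rewrite coef_rVpoly_ord mxE.
Qed.

(** The Hankel matrix of size n is the Gram matrix of 1, ..., x^(n-1), so its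
    determinant vanishes exactly when some nonzero polynomial of degree below n
    is orthogonal to all of these. *)
Lemma hankel_regular : hankel_nondegenerate m <->
  forall n p, (size p <= n)%N -> orth_below n p -> p = 0.
Proof.
split=> [nd n p pn op | reg n n1].
  case: n pn op => [|n] pn op; first by apply/eqP; rewrite -size_poly_eq0 -leqn0.
  have Hu : H n.+1 \in unitmx by rewrite unitmxE unitfE nd.
  have z : poly_rV p *m H n.+1 = 0.
    by apply/rowP => k; rewrite hankel_rVpoly poly_rV_K // op ?mxE.
  have : poly_rV p = 0 :> 'rV_n.+1 by rewrite -(mulmxK Hu (poly_rV p)) z mul0mx.
  by move/(congr1 rVpoly); rewrite poly_rV_K // linear0.
apply/det0P => -[c c0 cH]; case/eqP: c0.
rewrite -(rVpolyK c) (reg n (rVpoly c)) ?linear0 ?size_poly // => k kn.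
by have := hankel_rVpoly c (Ordinal kn); rewrite cH mxE.
Qed.

Lemma monic_subl n p q : p \is monic -> size p = n.+1 ->
  q \is monic -> size q = n.+1 -> (size (p - q)%R <= n)%N.
Proof.
move=> pm ps qm qs; apply/leq_sizeP => j; rewrite leq_eqVlt => /orP[/eqP <-|nj].
  move: pm qm; rewrite !monicE /lead_coef ps qs /= coefB => /eqP -> /eqP ->.
  by rewrite subrr.
by rewrite coefB !nth_default ?subrr ?ps ?qs.
Qed.

Definition is_monicOP n p :=
  [/\ p \is monic, size p = n.+1 & forall k, (k < n)%N -> L (p * 'X^k) = 0].

Lemma is_monicOP_unique n p q : hankel_nondegenerate m ->
  is_monicOP n p -> is_monicOP n q -> p = q.
Proof.
move=> /hankel_regular reg [pm ps po] [qm qs qo].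
apply/eqP; rewrite -subr_eq0; apply/eqP/(reg n); first exact: monic_subl.
by move=> k kn; rewrite mulrBl functionalB po // qo // subrr.
Qed.

Lemma is_monicOP_exists n : hankel_nondegenerate m -> exists p, is_monicOP n p.
Proof.
case: n => [|n] nd.
  by exists 1; split; rewrite ?monic1 ?size_poly1.
have Hu : H n.+1 \in unitmx by rewrite unitmxE unitfE nd.
pose b : 'rV[R[i]]_n.+1 := \row_k m (n.+1 + k)%N.
pose c := - b *m invmx (H n.+1).
have sc : (size (rVpoly c) < n.+2)%N by rewrite ltnS size_poly.
exists ('X^(n.+1) + rVpoly c); split.
- by rewrite monicE lead_coefDl ?size_polyXn // lead_coefXn.
- by rewrite size_polyDl size_polyXn.
- move=> k kn; rewrite mulrDl functionalD -exprD functionalXn.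
  by rewrite -(hankel_rVpoly c (Ordinal kn)) mulmxKV // !mxE subrr.
Qed.

Lemma monicOPP n : hankel_nondegenerate m -> is_monicOP n (monicOP m n).
Proof. by move=> /(is_monicOP_exists n)[p hp]; apply: (xgetI (P := is_monicOP n) 0 hp). Qed.

Lemma monicOP_orthogonal : hankel_nondegenerate m -> monic_orthogonal m (monicOP m).
Proof.
move=> nd; have reg := hankel_regular.1 nd.
have PP n := monicOPP n nd; split=> [n|n k nk|n].
- by have [] := PP n.
- wlog kn : n k nk / (k < n)%N => [th|].
    have [kn|nk'|kn] := ltngtP k n; [exact: th| |by case: nk].
    by rewrite mulrC; apply: th nk' => /esym.
  have [_ _ /orth_belowP->] // := PP n.
  by have [_ -> _] := PP k.
- apply/eqP => z; have [pm ps po] := PP n.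
  have := monic_neq0 pm; rewrite (reg n.+1 (monicOP m n)) ?ps ?eqxx // => k.
  rewrite ltnS leq_eqVlt => /orP[/eqP -> | kn]; last exact: po.
  have e : 'X^n = monicOP m n - (monicOP m n - 'X^n) by rewrite opprB addrC subrK.
  rewrite e mulrBr functionalB -expr2 z (orth_belowP po) ?subrr //.
  by apply: monic_subl; rewrite ?monicXn ?size_polyXn.
Qed.

Section FromOrthogonal.
Variable P : nat -> {poly R[i]}.
Hypothesis orthP : monic_orthogonal m P.

Let Pm n : P n \is monic. Proof. by have [/(_ n)[]] := orthP. Qed.
Let Ps n : size (P n) = n.+1. Proof. by have [/(_ n)[]] := orthP. Qed.

Lemma size_reduce p d : size p = d.+1 -> (size (p - lead_coef p *: P d)%R <= d)%N.
Proof.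
move=> ps; apply/leq_sizeP => j; rewrite leq_eqVlt => /orP[/eqP <-|dj].
  have := monicP (Pm d); rewrite /lead_coef Ps ps /= coefB coefZ => ->.
  by rewrite mulr1 subrr.
by rewrite coefB coefZ !nth_default ?mulr0 ?subrr ?ps ?Ps.
Qed.

(** Induction on the degree, subtracting a multiple of P_d to lower it. *)
Lemma orthogonal_lower n q : (size q <= n)%N -> L (P n * q) = 0.
Proof.
move sq : (size q) => s; elim/ltn_ind: s q sq => s IH q qs sn.
case: s qs IH sn => [/eqP|s] qs IH sn.
  by move: qs; rewrite size_poly_eq0 => /eqP ->; rewrite mulr0 functional0.
rewrite -(subrK (lead_coef q *: P s) q) mulrDr functionalD.
have ns : n <> s by move=> ns; move: sn; rewrite ns ltnn.
rewrite -scalerAr functionalZ; have [_ /(_ _ _ ns) -> _] := orthP.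
rewrite mulr0 addr0; have h := size_reduce qs.
apply: (IH (size (q - lead_coef q *: P s)%R)) => //.
exact: leq_trans h (ltnW sn).
Qed.

(** A nonzero p of degree d < n orthogonal to all degrees below n would be
    orthogonal to P_d, but its inner product with P_d is the leading coefficient
    of p times L(P_d^2). *)
Lemma monic_orthogonal_nondegenerate : hankel_nondegenerate m.
Proof.
apply/hankel_regular => n p pn op; apply/eqP/negPn/negP => p0.
have ps : size p = (size p).-1.+1 by rewrite prednK // size_poly_gt0.
set d := (size p).-1 in ps; have dn : (d < n)%N by rewrite -ps.
have : L (p * P d) = 0 by apply: orth_belowP op _; rewrite Ps.
rewrite -(subrK (lead_coef p *: P d) p) mulrDl functionalD mulrC.
rewrite orthogonal_lower ?size_reduce // add0r -scalerAl functionalZ -expr2.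
have [_ _ h] := orthP; move/eqP; rewrite mulf_eq0 (negPf (h d)) orbF lead_coef_eq0.
by rewrite (negPf p0).
Qed.

Lemma monic_orthogonalE n : monicOP m n = P n.
Proof.
have nd := monic_orthogonal_nondegenerate.
apply: is_monicOP_unique nd (monicOPP n nd) _; split=> // k kn.
by rewrite orthogonal_lower // size_polyXn.
Qed.
End FromOrthogonal.
End Orthogonal.

Lemma functional_scale (R : realType) (m m' : nat -> R[i]) c p :
  (forall n, m' n = c * m n) -> functional_of_moments m' p = c * functional_of_moments m p.
Proof.
move=> mE; rewrite /functional_of_moments mulr_sumr.
by apply: eq_bigr => i _; rewrite mE mulrCA.
Qed.

Lemma monicOP_scale (R : realType) (m m' : nat -> R[i]) c n : c != 0 ->
  (forall n, m' n = c * m n) -> monicOP m' n = monicOP m n.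
Proof.
move=> c0 mE; rewrite /monicOP; congr (xget 0 _); apply/seteqP; split=> p /= [pm ps po].
  split=> // k /po /eqP; rewrite (functional_scale _ mE) mulf_eq0 (negPf c0) /=.
  by move/eqP.
by split=> // k /po h; rewrite (functional_scale _ mE) h mulr0.
Qed.

Section Umbral.
Variables (R : realType) (mu g gt : nat -> R[i]).
Hypotheses (mu0 : mu 0%N = 0) (g0 : g 0%N = 1).
Hypothesis mug : forall n m, (1 <= n)%N ->
  mu n * mu m.+1 * gt (n + m - 1)%N = g (n + m + 1)%N - g m.+1 * g n.

Local Notation D := (umbralD mu).
Local Notation L := (functional_of_moments g).
Local Notation Lt := (functional_of_moments gt).

(** The hypothesis on the moments, extended to the indices i = 0 and j = 0 where
    both sides vanish. *)
Lemma umbral_moments i j : mu i * mu j * gt (i.-1 + j.-1)%N = g (i + j)%N - g i * g j.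
Proof.
case: i => [|i]; first by rewrite mu0 g0 !mul0r mul1r add0n subrr.
case: j => [|j]; first by rewrite mu0 g0 mulr0 mul0r mulr1 addn0 subrr.
rewrite /=; have := mug j (ltn0Sn i); have -> : (i.+1 + j - 1 = i + j)%N by lia.
have -> : (i.+1 + j + 1 = i.+1 + j.+1)%N by lia.
by move=> ->; rewrite [g j.+1 * _]mulrC.
Qed.

(** The previous identity is the case p = x^i, q = x^j. *)
Lemma umbral_product p q : Lt (D p * D q) = L (p * q) - L p * L q.
Proof.
have -> : L (p * q) = \sum_(i < size p) \sum_(j < size q) p`_i * q`_j * g (i + j)%N.
  rewrite -{1}(coefK p) poly_def mulr_suml functional_sum; apply: eq_bigr => i _.
  rewrite -{1}(coefK q) poly_def mulr_sumr functional_sum; apply: eq_bigr => j _.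
  rewrite -scalerAl -scalerAr !functionalZ -exprD functionalXn; ring.
rewrite (functional_widen g (leqnn (size p))) (functional_widen g (leqnn (size q))).
rewrite [D p]/umbralD !mulr_suml -sumrB functional_sum; apply: eq_bigr => i _.
rewrite /umbralD !mulr_sumr -sumrB functional_sum; apply: eq_bigr => j _.
rewrite -scalerAl -scalerAr !functionalZ -exprD functionalXn.
transitivity (p`_i * q`_j * (mu i * mu j * gt (i.-1 + j.-1)%N)); first by ring.
rewrite umbral_moments; ring.
Qed.

Hypothesis mu_neq0 : forall n, (1 <= n)%N -> mu n != 0.

Lemma umbralD_size (p : {poly R[i]}) n : size p = n.+2 ->
  size (D p) = n.+1 /\ lead_coef (D p) = lead_coef p * mu n.+1.
Proof.
move=> ps.
have DE : D p = \poly_(i < n.+1) (p`_i.+1 * mu i.+1).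
  rewrite poly_def /umbralD ps big_ord_recl mu0 mulr0 scale0r add0r.
  by apply: eq_bigr => i _.
have lc : p`_n.+1 * mu n.+1 != 0.
  rewrite mulf_neq0 ?mu_neq0 //; have : lead_coef p != 0.
    by rewrite lead_coef_eq0 -size_poly_eq0 ps.
  by rewrite /lead_coef ps.
by rewrite DE size_poly_eq // lead_coef_poly // /lead_coef ps.
Qed.

(** For n, k >= 1 the correction L(P_n) L(P_k) vanishes, so D maps P_n and P_k to
    polynomials with the same inner product. *)
Lemma umbral_orthogonal P : monic_orthogonal g P ->
  monic_orthogonal gt (fun n => (mu n.+1)^-1 *: D (P n.+1)).
Proof.
move=> oP; have [Pmon Port Pnz] := oP.
have L0 n : L (P n.+1) = 0 by rewrite -[P _]mulr1 (orthogonal_lower oP) ?size_poly1.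
have key n k : Lt ((mu n.+1)^-1 *: D (P n.+1) * ((mu k.+1)^-1 *: D (P k.+1))) =
    (mu n.+1)^-1 * (mu k.+1)^-1 * L (P n.+1 * P k.+1).
  by rewrite -scalerAl -scalerAr !functionalZ umbral_product !L0 mulr0 subr0 mulrA.
have mi n : (mu n.+1)^-1 != 0 by rewrite invr_eq0 mu_neq0.
split=> [n|n k nk|n].
- have [pm ps] := Pmon n.+1; have [Ds Dl] := umbralD_size ps.
  rewrite size_scale // Ds monicE lead_coefZ Dl (monicP pm) mul1r mulVf ?mu_neq0 //.
- by rewrite key Port ?mulr0 // => -[/nk].
- by rewrite expr2 key !mulf_neq0 ?mi // -expr2.
Qed.
End Umbral.

(** * The umbral classical property *)

Theorem mainTheorem10 (R : realType) (g2 g3 : R[i]) (sigma : R[i] -> R[i])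
    (w alpha beta : R[i])
    (hsigma : weierstrass_sigma g2 g3 sigma)
    (hw : w != 0) (halpha : alpha != 0) (hbeta : beta != 0)
    (hab : alpha != beta)
    (hsb : sigma (w * beta) != 0)
    (hsna : forall n : nat, sigma (w * (n%:R + alpha)) != 0)
    (hsn : forall n : nat, (1 <= n)%N -> sigma (w * n%:R) != 0) :
  let mu (n : nat) : R[i] := sigma (w * n%:R) / sigma (w * (n%:R + alpha)) in
  let g (n : nat) : R[i] :=
    sigma (w * alpha) / sigma (w * beta)
    * (sigma (w * (n%:R + beta)) / sigma (w * (n%:R + alpha))) in
  let gt (n : nat) : R[i] :=
    (sigma (w * alpha) * sigma (w * (beta - alpha))
     * sigma (w * (n%:R + alpha + beta + 2)))
    / (sigma (w * beta) ^+ 2 * sigma (w * (n%:R + alpha + 2))) in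
  [/\ mu 0%N = 0,
      g 0%N = 1,
      forall n m : nat, (1 <= n)%N ->
        mu n * mu m.+1 * gt (n + m - 1)%N
        = g (n + m + 1)%N - g m.+1 * g n
    & hankel_nondegenerate g ->
      let P := monicOP g in
      let Q (n : nat) : {poly R[i]} := (mu n.+1)^-1 *: umbralD mu (P n.+1) in
      [/\ monic_orthogonal g P,
          (forall n : nat, P n = sigmaOP sigma w alpha beta n),
          hankel_nondegenerate gt,
          monic_orthogonal gt Q
        & (forall n : nat,
             Q n = sigmaOP sigma w (alpha + 2) (alpha + beta + 2) n)]].
Proof.
move=> mu g gt.
have sw : exists2 c, sigma c != 0 & sigma (2 * c) != 0.
  exists w; first by have := hsn 1 isT; rewrite mulr1.
  by have := hsn 2 isT; rewrite mulrC.
have s0 : sigma 0 = 0 := sigma0 hsigma.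
have sA : sigma (w * alpha) != 0 by have := hsna 0; rewrite add0r.
have mu0 : mu 0 = 0 by rewrite /mu mulr0 s0 mul0r.
have g0 : g 0 = 1 by rewrite /g !add0r; field; rewrite sA hsb.
have mug : forall n m : nat, (1 <= n)%N ->
    mu n * mu m.+1 * gt (n + m - 1)%N = g (n + m + 1)%N - g m.+1 * g n.
  move=> n m n1.
  have key := sigma_three_term hsigma sw (w * n%:R) (w * m.+1%:R) (w * alpha) (w * beta).
  have sum_eq : (n + m + 1)%N = (n + m.+1)%N by rewrite addn1 addnS.
  have e2 : (n + m - 1)%:R + 2 = n%:R + m.+1%:R :> R[i].
    by rewrite -!natrD; congr _%:R; lia.
  have hA := hsna (n + m.+1)%N; have hn := hsna n; have hm := hsna m.+1.
  rewrite /mu /gt /g sum_eq.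
  have -> : (n + m - 1)%:R + alpha + beta + 2 = n%:R + m.+1%:R + alpha + beta :> R[i].
    by rewrite -e2; ring.
  have -> : (n + m - 1)%:R + alpha + 2 = n%:R + m.+1%:R + alpha :> R[i].
    by rewrite -e2; ring.
  rewrite natrD in hA *; move: key hA hn hm; rewrite !mulrDr !mulrN.
  set a := w * n%:R; set b := w * m.+1%:R; set A := w * alpha; set B := w * beta.
  rewrite -/A -/B in sA hsb => key hA hn hm.
  set SaAB := sigma (a + b + A + B) in key *.
  have -> : sigma a / sigma (a + A) * (sigma b / sigma (b + A)) *
      (sigma A * sigma (B - A) * SaAB / (sigma B ^+ 2 * sigma (a + b + A))) =
      sigma A / (sigma (a + A) * sigma (b + A) * sigma B ^+ 2 * sigma (a + b + A))
      * (sigma a * sigma b * sigma (B - A) * SaAB).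
    by field; rewrite hA hn hm hsb.
  by rewrite key; field; rewrite hA hn hm hsb.
split=> // nd P Q.
have oP : monic_orthogonal g P := monicOP_orthogonal nd.
have mu_neq0 n : (1 <= n)%N -> mu n != 0.
  by move=> n1; rewrite /mu mulf_neq0 ?invr_eq0 ?hsn.
have oQ : monic_orthogonal gt Q := umbral_orthogonal mu0 g0 mug mu_neq0 oP.
have ndt := monic_orthogonal_nondegenerate oQ.
split=> // n.
  apply: monicOP_scale => [|k]; last by [].
  by rewrite mulf_neq0 ?invr_eq0.
rewrite -(monic_orthogonalE oQ) /sigmaOP.
pose c := sigma (w * alpha) * sigma (w * (beta - alpha)) / sigma (w * beta) ^+ 2.
have gtE k : gt k = c * (sigma (w * (k%:R + (alpha + beta + 2)))
                         / sigma (w * (k%:R + (alpha + 2)))).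
  by rewrite /gt /c !addrA invfM; ring.
apply: (@monicOP_scale _ _ _ c) => //.
have := ndt 1%N isT; rewrite det_mx11 mxE /= gtE; apply: contraNneq => ->.
by rewrite mul0r.
Qed.
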